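(* Let $d\ge2$ and $\Phi=2U_1$. Let $\Sigma$ be an increasing, rotation invariant, simple size functional, and let $a>0$ be such that $\Sigma^{-1}([a,\infty))\ne\emptyset$. Let $\vartheta$ be a rotation invariant deviation functional for $\Phi,\Sigma,a$, and let $f_a$ be a stability function for $\Phi,\Sigma,a,\vartheta$. If $\varepsilon\in(0,1]$ and $\kappa\in(0,1)$, then there is a constant $c_{10}>0$, depending on $a,d,\varepsilon,\kappa,\Sigma,\vartheta$, such that for every $\gamma_s\in(0,\infty)$ the typical cell $Z$ of the hypersphere tessellation derived from an isotropic Poisson point process $X$ on $\mathbb{S}^d$ with intensity $\gamma_s$ satisfies $$\mathbb{P}\left(\vartheta(Z)\ge\varepsilon\mid\Sigma(Z)\ge a\right)\le c_{10}\exp\left(-\kappa\,\gamma_s\,f_a(\varepsilon)\,\tau(\Phi,\Sigma,a)\right).$$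
   Context: $\mathbb{S}^d$ is the unit sphere in $\mathbb{R}^{d+1}$ ($d\ge2$), $\sigma_d^\circ$ its normalized (probability) spherical Lebesgue measure, $\mathsf p\in\mathbb{S}^d$ a fixed point, $o$ the zero vector. $\overline{\mathcal{K}}^d_s$ is the set of spherically convex bodies, i.e. intersections of $\mathbb{S}^d$ with a closed convex cone in $\mathbb{R}^{d+1}$ that is not a linear subspace, with the spherical Hausdorff metric; $\widehat{\mathcal{K}}^d_s=\overline{\mathcal{K}}^d_s\cup\{\mathbb{S}^d\}$. $U_1(K)=\frac12\int_{\mathbb{S}^d}\mathbf 1\{x^\perp\cap K\ne\emptyset\}\,\sigma_d^\circ(dx)$. A size functional is a continuous map $\Sigma:\overline{\mathcal{K}}^d_s\to[0,\infty)$ with $\Sigma\not\equiv0$ and $\Sigma(\{e\})=0$ for all $e\in\mathbb{S}^d$; increasing refers to set inclusion; simple means $\Sigma(K)=0$ whenever $K$ is not $d$-dimensional. Convention: $\Sigma$ is extended to $\mathbb{S}^d$ by a value with $\Sigma(\mathbb{S}^d)\ge\Sigma(K)$ for all $K\in\overline{\mathcal{K}}^d_s$. $\Sigma^{-1}([a,\infty))=\{K\in\overline{\mathcal{K}}^d_s:\Sigma(K)\ge a\}$; $\tau(\Phi,\Sigma,a)=\min\{\Phi(K):K\in\overline{\mathcal{K}}^d_s,\Sigma(K)\ge a\}$; $\mathcal{E}(\Phi,\Sigma,a)=\{K\in\overline{\mathcal{K}}^d_s:\Sigma(K)\ge a,\Phi(K)=\tau(\Phi,\Sigma,a)\}$.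 A deviation functional for $\Phi,\Sigma,a$ is a continuous map $\vartheta:\Sigma^{-1}([a,\infty))\to[0,\infty)$ with $\vartheta(K)=0$ iff $K\in\mathcal{E}(\Phi,\Sigma,a)$. A stability function for $\Phi,\Sigma,a,\vartheta$ is an increasing $f_a:[0,\infty)\to[0,1]$ with $f_a(0)=0$, $f_a(t)>0$ for $t>0$, and $\Phi(K)\ge(1+f_a(t))\tau(\Phi,\Sigma,a)$ for all $t\ge0$ and all $K\in\Sigma^{-1}([a,\infty))$ with $\vartheta(K)\ge t$. An isotropic Poisson point process $X$ with intensity $\gamma_s$ is a Poisson process on $\mathbb{S}^d$ with intensity measure $\gamma_s\sigma_d^\circ$. The associated hypersphere tessellation partitions $\mathbb{S}^d$ by the great hyperspheres $\mathbb{S}^d\cap x^\perp$, $x\in X$ (if $X$ is empty the only cell is $\mathbb{S}^d$); let $X'$ be the point process of its cells, with intensity $\gamma_{X'}=\mathbb{E}[\text{number of cells}]$. Let $c_s$ be a measurable centre function from the nonempty compact subsets of $\mathbb{S}^d$ to $\mathbb{S}^d\cup\{o\}$ with $c_s(\varrho C)=\varrho c_s(C)$ for $\varrho\in\mathrm{SO}(d+1)$. Let $\kappa_0(\mathsf p,\cdot)$ be the invariant probability measure on the stabilizer of $\mathsf p$ in $\mathrm{SO}(d+1)$, $\kappa_0(x,\cdot)$ for $x\in\mathbb{S}^d$ its image under $\varrho\mapsto\varrho_x\circ\varrho$ for any rotation $\varrho_x$ with $\varrho_x\mathsf p=x$, and $\kappa_0(o,\cdot)$ the Haar probability measure on $\mathrm{SO}(d+1)$.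 The typical cell $Z$ has distribution $\mathbb{P}(Z\in\cdot)=\frac1{\gamma_{X'}}\mathbb{E}\int\int_{\mathrm{SO}(d+1)}\mathbf 1\{\varphi^{-1}K\in\cdot\}\,\kappa_0(c_s(K),d\varphi)\,X'(dK)$. Convention: the event $\{\vartheta(Z)\ge\varepsilon\}$ (given $\Sigma(Z)\ge a$) is understood to require $Z\in\overline{\mathcal{K}}^d_s$. *)

(* Defs.v *)
From HB Require Import structures.
From mathcomp Require Import all_boot all_order all_algebra.
From mathcomp Require Import all_classical all_reals all_analysis.

Set Implicit Arguments.
Unset Strict Implicit.
Unset Printing Implicit Defensive.

Import Order.TTheory GRing.Theory Num.Theory.
Import numFieldNormedType.Exports.

Local Open Scope classical_set_scope.
Local Open Scope ring_scope.

(* Points of R^{d+1} are row vectors; the topology that the library puts on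
   'rV[R]_d.+1 is the product (Euclidean) topology, but its norm is the sup
   norm, so the Euclidean structure below is expressed through dotp only. *)

Section Sphere.
Context {R : realType} {d : nat}.
Local Notation E := 'rV[R]_d.+1.

Definition dotp (x y : E) : R := \sum_(i < d.+1) x 0 i * y 0 i.

Definition sphere : set E := [set x | dotp x x = 1].

Definition SO : set 'M[R]_d.+1 := [set M | M *m M^T = 1%:M /\ \det M = 1].

(* The transpose makes rotv a left action: rotv (M *m N) = rotv M \o rotv N. *)
Definition rotv (M : 'M[R]_d.+1) (x : E) : E := x *m M^T.

Definition closed_convex_cone (C : set E) : Prop :=
  [/\ closed C, C 0 &
      forall (s t : R) x y, 0 <= s -> 0 <= t -> C x -> C y ->
        C (s *: x + t *: y)].

Definition linear_subspace (C : set E) : Prop :=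
  exists U : {vspace E}, C = [set x | x \in U].

Definition convex_body : set (set E) :=
  [set K | exists C : set E,
    [/\ closed_convex_cone C, ~ linear_subspace C & K = sphere `&` C]].

Definition sdist (x y : E) : R := acos (dotp x y).

Definition sdist_set (x : E) (K : set E) : R := inf [set sdist x y | y in K].

Definition hausdorff_dist (K L : set E) : R :=
  Num.max (sup [set sdist_set x L | x in K]) (sup [set sdist_set y K | y in L]).

Definition hausdorff_continuous_on (D : set (set E)) (F : set E -> R) : Prop :=
  forall K, D K -> forall e : R, 0 < e -> exists2 r : R, 0 < r &
    forall L, D L -> hausdorff_dist K L < r -> `|F K - F L| < e.

Definition rotation_invariant_on (D : set (set E)) (F : set E -> R) : Prop :=
  forall M K, SO M -> D K -> F (rotv M @` K) = F K.

(* The linear hull of K has dimension m + 1. *)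
Definition has_sphere_dim (K : set E) (m : nat) : Prop :=
  exists U : {vspace E},
    [/\ forall x, K x -> x \in U,
        forall V : {vspace E}, (forall x, K x -> x \in V) -> (U <= V)%VS &
        \dim U = m.+1].

End Sphere.

Arguments sphere : clear implicits.
Arguments SO : clear implicits.
Arguments convex_body : clear implicits.

(* Lebesgue measure on Borel sets of R^n, as an iterated integral over the
   coordinates (Cavalieri / Tonelli). *)
Fixpoint lebesgue_rV {R : realType} (n : nat) : set 'rV[R]_n -> \bar R :=
  match n return set 'rV[R]_n -> \bar R with
  | 0 => fun A => (\1_A (0 : 'rV[R]_0))%:E
  | m.+1 => fun A =>
      (\int[@lebesgue_measure R]_x
         lebesgue_rV [set v : 'rV[R]_m | A (row_mx (x%:M : 'rV[R]_1) v)])%E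
  end.

Section SphericalMeasure.
Context {R : realType} {d : nat}.
Local Notation E := 'rV[R]_d.+1.

Definition cone_over (A : set E) : set E :=
  [set r *: x | r in [set r : R | 0 <= r <= 1] & x in A `&` sphere R d].

(* The normalized spherical Lebesgue measure: the proportion of the volume of
   the unit ball which is taken by the cone over A. *)
Definition sigma (A : set E) : \bar R :=
  (lebesgue_rV (cone_over A) / lebesgue_rV [set x : E | (dotp x x <= 1)%R])%E.

(* The integral of the indicator of {x in S^d : x^perp meets K} is the measure
   of that set. *)
Definition U1 (K : set E) : R :=
  2^-1 * fine (sigma [set x | sphere R d x /\
                              exists2 y, K y & dotp x y = 0]).

End SphericalMeasure.

Section Functionals.
Context {R : realType} {d : nat}.
Local Notation E := 'rV[R]_d.+1.
Implicit Types (Phi Sigma theta : set E -> R) (a : R).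

(* Functionals are total functions on subsets of R^{d+1}; only their values on
   convex bodies and, for size functionals, on the whole sphere matter. *)

Record size_functional Sigma : Prop := SizeFunctional {
  size_continuous : hausdorff_continuous_on (convex_body R d) Sigma ;
  size_ge0 : forall K, convex_body R d K -> 0 <= Sigma K ;
  size_neq0 : exists2 K, convex_body R d K & Sigma K != 0 ;
  size_point : forall e, sphere R d e -> Sigma [set e] = 0 }.

Definition increasing_functional Sigma : Prop :=
  forall K L, convex_body R d K -> convex_body R d L -> K `<=` L ->
    Sigma K <= Sigma L.

Definition simple_functional Sigma : Prop :=
  forall K, convex_body R d K -> ~ has_sphere_dim K d -> Sigma K = 0.

Definition superlevel Sigma a : set (set E) :=
  [set K | convex_body R d K /\ a <= Sigma K].

(* A minimum whenever Phi and Sigma are continuous, since the space of convex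
   bodies is compact. *)
Definition tau Phi Sigma a : R := inf [set Phi K | K in superlevel Sigma a].

Definition extremal Phi Sigma a : set (set E) :=
  [set K | superlevel Sigma a K /\ Phi K = tau Phi Sigma a].

Record deviation_functional Phi Sigma a theta : Prop := DeviationFunctional {
  dev_continuous : hausdorff_continuous_on (superlevel Sigma a) theta ;
  dev_ge0 : forall K, superlevel Sigma a K -> 0 <= theta K ;
  dev_eq0 : forall K, superlevel Sigma a K ->
    (theta K = 0 <-> extremal Phi Sigma a K) }.

Record stability_function Phi Sigma a theta (f : R -> R) : Prop :=
  StabilityFunction {
  stab_range : forall t, 0 <= t -> 0 <= f t <= 1 ;
  stab_incr : forall s t, 0 <= s -> s <= t -> f s <= f t ;
  stab_0 : f 0 = 0 ;
  stab_gt0 : forall t, 0 < t -> 0 < f t ;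
  stab_lower : forall t K, 0 <= t -> superlevel Sigma a K -> t <= theta K ->
    (1 + f t) * tau Phi Sigma a <= Phi K }.

End Functionals.

(* The measurable space of a topological space with its Borel sets. *)
Notation borel T := (g_sigma_algebraType (@open T)) (only parsing).
Notation borel_set := ((@open _).-sigma.-measurable) (only parsing).

Section PoissonProcess.
Context {R : realType} {d : nat} {dO : measure_display}
  {Omega : measurableType dO}.
Local Notation E := 'rV[R]_d.+1.

Definition counts (s : seq E) (A : set E) : nat := count (fun x => x \in A) s.

(* A finite counting measure on the sphere is represented by a list of its
   atoms, repeated according to multiplicity; the order is irrelevant since X
   is only observed through the counts of Borel sets. *)
Record poisson_process (P : probability Omega R) (gamma : R)
    (X : Omega -> seq E) : Prop := PoissonProcess {
  pp_sphere : forall w x, x \in X w -> sphere R d x ;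
  pp_measurable : forall (A : set E) k, borel_set A ->
    measurable [set w | counts (X w) A = k] ;
  pp_poisson : forall (A : set E) k, borel_set A ->
    let r := gamma * fine (sigma A) in
    P [set w | counts (X w) A = k] = (r ^+ k / k`!%:R * expR (- r))%:E ;
  pp_independent : forall n (A : 'I_n -> set E) (k : 'I_n -> nat),
    (forall i, borel_set (A i)) -> trivIset setT A ->
    P [set w | forall i, counts (X w) (A i) = k i] =
    (\prod_(i < n) P [set w | counts (X w) (A i) = k i])%E }.

End PoissonProcess.

Section TypicalCell.
Context {R : realType} {d : nat}.
Local Notation E := 'rV[R]_d.+1.
Local Notation M := 'M[R]_d.+1.

Definition off_hyperspheres (s : seq E) : set E :=
  [set y | sphere R d y /\ forall x, x \in s -> dotp x y != 0].

(* The cells are the closures of the connected components of the complement of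
   the union of the great hyperspheres. *)
Definition cells (s : seq E) : set (set E) :=
  [set closure (connected_component (off_hyperspheres s) y)
    | y in off_hyperspheres s].

Definition sphere_compacts : set (set E) :=
  [set K | [/\ compact K, K !=set0 & K `<=` sphere R d]].

Definition hausdorff_open (U : set (set E)) : Prop :=
  U `<=` sphere_compacts /\
  forall K, U K -> exists2 r : R, 0 < r &
    forall L, sphere_compacts L -> hausdorff_dist K L < r -> U L.

Record centre_function (c : set E -> E) : Prop := CentreFunction {
  centre_range : forall K, sphere_compacts K -> sphere R d (c K) \/ c K = 0 ;
  centre_measurable : forall B : set E, borel_set B ->
    <<s sphere_compacts, [set U | hausdorff_open U] >>
      (sphere_compacts `&` c @^-1` B) ;
  centre_equivariant : forall Q K, SO R d Q -> sphere_compacts K ->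
    c (rotv Q @` K) = rotv Q (c K) }.

(* For a compact group G of rotations there is exactly one such mu; it is also
   right invariant. *)
Definition haar_probability (G : set M) (mu : probability (borel M) R) : Prop :=
  mu G = 1%E /\
  forall Q (A : set M), G Q -> borel_set A -> mu [set S | A (Q *m S)] = mu A.

Definition stabilizer (p : E) : set M := [set Q | SO R d Q /\ rotv Q p = p].

Record kappa0_kernel (p : E) (kappa0 : E -> probability (borel M) R) : Prop :=
  Kappa0Kernel {
  kappa0_base : haar_probability (stabilizer p) (kappa0 p) ;
  kappa0_image : forall x Q, sphere R d x -> SO R d Q -> rotv Q p = x ->
    forall A : set M, borel_set A -> kappa0 x A = kappa0 p [set S | A (Q *m S)] ;
  kappa0_origin : haar_probability (SO R d) (kappa0 0) }.

Context {dO : measure_display} {Omega : measurableType dO}.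

Definition cell_intensity (P : probability Omega R) (X : Omega -> seq E)
    : \bar R :=
  (\int[P]_w \esum_(K in cells (X w)) 1)%E.

(* P(Z \in A); for a rotation S, the image of K under S^-1 is written as the
   preimage of K under S. *)
Definition typical_cell_law (P : probability Omega R) (X : Omega -> seq E)
    (c : set E -> E) (kappa0 : E -> probability (borel M) R)
    (A : set (set E)) : \bar R :=
  ((cell_intensity P X)^-1 *
   \int[P]_w \esum_(K in cells (X w))
     \int[kappa0 (c K)]_(S in SO R d) (\1_A (rotv S @^-1` K))%:E)%E.

Definition cond_law (mu : set (set E) -> \bar R) (A B : set (set E)) : \bar R :=
  (mu (A `&` B) / mu B)%E.

End TypicalCell.

(* Main.v *)
Require Import Defs.
From HB Require Import structures.
From mathcomp Require Import all_boot all_order all_algebra.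
From mathcomp Require Import all_classical all_reals all_analysis.
From mathcomp Require Import measurable_realfun zify ring lra.

                                                                                
                                                                                 
                                                                             
                                                                                 
                                                        

                                                                             
                                                                             
                                                     

                                                                                 
                                                                
                                                                                  
                                                                               
                                                         
                                                                              
                                                    
                                                                             

                                                                          
                                                                                
                                                                   

(** Let [mu] be the real-valued spherical measure. Then [Phi K] is [mu (hits K)], the measure of the
    hyperplanes that meet [K], and a Poisson process of intensity g avoids a set A with probability
    exp(-g mu(A)). Both events in the conditional probability are rotation invariant on cells, so
    averaging over rotations changes nothing ([typical_cell_law_invariant]). What remains is a ratio
    of two expected numbers of cells: the bad cells, with Sigma >= a and theta >= eps, over all
    cells with Sigma >= a.

    Denominator ([esum_cells_ge]): choose [K1] with Sigma(K1) >= a and Phi(K1) almost minimal. When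
    no hyperplane hits [K1], it lies in a single cell, which has Sigma >= a by monotonicity. The
    expectation is therefore at least exp(-g Phi(K1)).

    Numerator ([esum_cells_le]): bodies with Sigma >= a are full-dimensional because Sigma is
    simple. Near such a body there is a finite point set [J] that lies in the interior of the cone
    over every nearby body and is hit by nearly as many hyperplanes ([local_approximation]). By
    compactness ([superlevel_compact]) finitely many such [J] serve all bodies with Sigma >= a. A
    bad cell holds one of them in its interior, that [J] determines the cell, and no hyperplane of
    the process separates the points of [J]. So the expected number of bad cells is at most N exp(-g
    m), where m is almost the infimum of Phi over bad bodies. That infimum exceeds tau by a gap of
    at least f(eps) tau, and the small losses in both estimates are paid for by kappa < 1. N depends
    neither on g nor on f.

    Since the measure is given by an iterated integral, its monotonicity and continuity are read off
    from the void probabilities of a Poisson process. The one fact proved on the integral itself is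
    that tangent hyperplanes form a null set ([mu_tangent], from [lebesgue_rV_thin]). Compactness of
    the space of convex bodies is obtained from ultrafilter limits of cones. *)

Set Implicit Arguments.
Unset Strict Implicit.
Unset Printing Implicit Defensive.

Import Order.TTheory GRing.Theory Num.Theory.
Import numFieldNormedType.Exports.

Local Open Scope classical_set_scope.
Local Open Scope ring_scope.

                                          

(** * Euclidean geometry of the sphere *)

Section Euclid.
Context {R : realType} {d : nat}.
Local Notation E := 'rV[R]_d.+1.
Implicit Types (x y z u v w : E) (e : R).

Lemma dotpC x y : dotp x y = dotp y x.
Proof. by apply: eq_bigr => i _; rewrite mulrC. Qed.

Lemma dotpDl x y z : dotp (x + y) z = dotp x z + dotp y z.
Proof. by rewrite -big_split; apply: eq_bigr => i _; rewrite !mxE mulrDl. Qed.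

Lemma dotpZl t x y : dotp (t *: x) y = t * dotp x y.
Proof. by rewrite /dotp mulr_sumr; apply: eq_bigr => i _; rewrite !mxE mulrA. Qed.

Lemma dotpDr x y z : dotp x (y + z) = dotp x y + dotp x z.
Proof. by rewrite dotpC dotpDl !(dotpC x). Qed.

Lemma dotpZr t x y : dotp x (t *: y) = t * dotp x y.
Proof. by rewrite dotpC dotpZl dotpC. Qed.

Lemma dotpNl x y : dotp (- x) y = - dotp x y.
Proof. by rewrite -scaleN1r dotpZl mulN1r. Qed.

Lemma dotpNr x y : dotp x (- y) = - dotp x y.
Proof. by rewrite dotpC dotpNl dotpC. Qed.

Lemma dotp_sqrD x y : dotp (x + y) (x + y) = dotp x x + 2 * dotp x y + dotp y y.
Proof. by rewrite !(dotpDl, dotpDr) (dotpC y x); ring. Qed.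

Lemma dotp0 x : dotp x 0 = 0.
Proof. by rewrite -(scale0r x) dotpZr mul0r. Qed.

Lemma dotp_sumr (I : Type) (r : seq I) (F : I -> E) x :
  dotp x (\sum_(i <- r) F i) = \sum_(i <- r) dotp x (F i).
Proof. by elim/big_rec2: _ => [|i y1 y2 _ <-]; rewrite ?dotp0// dotpDr. Qed.

Lemma dotpp_ge0 x : 0 <= dotp x x.
Proof. by apply: sumr_ge0 => i _; rewrite -expr2 sqr_ge0. Qed.

Lemma dotpp_eq0 x : (dotp x x == 0) = (x == 0).
Proof.
apply/idP/eqP => [/eqP x0|->]; last by rewrite dotp0.
apply/rowP => i; rewrite mxE; apply/eqP.
have sq_ge0 j : true -> 0 <= x 0 j * x 0 j by rewrite -expr2 sqr_ge0.
by have := psumr_eq0P sq_ge0 x0 isT => /(_ i)/eqP; rewrite -expr2 sqrf_eq0.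
Qed.

Lemma dotpp_gt0 x : (0 < dotp x x) = (x != 0).
Proof. by rewrite lt_def dotpp_ge0 andbT dotpp_eq0. Qed.

Lemma cvg_dotp (T : Type) (F : set_system T) {FF : Filter F} (f g : T -> E) x y :
  f @ F --> x -> g @ F --> y ->
  dotp (f t) (g t) @[t --> F] --> dotp x y.
Proof.
move=> fx gy; rewrite /dotp.
apply: (cvg_big (@add_continuous R)) => i _.
have coordE z : (fun M : E => M 0 i) @ z --> z 0 i by exact: coord_continuous.
by apply: cvgM; [exact: cvg_comp fx (coordE x)|exact: cvg_comp gy (coordE y)].
Qed.

Lemma dotp_continuous x : continuous (dotp x).
Proof.
move=> y; apply: (@cvg_dotp E (nbhs y) _ (fun=> x) id x y); first exact: cvg_cst.
exact: cvg_id.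
Qed.

Lemma sphere_neq0 x : sphere R d x -> x != 0.
Proof. by rewrite -dotpp_gt0 => ->. Qed.

Lemma sphereN x : sphere R d x -> sphere R d (- x).
Proof. by rewrite /sphere/= dotpNl dotpNr opprK. Qed.

Lemma sphere_closed : closed (sphere R d).
Proof.
have -> : sphere R d = (fun x => dotp x x) @^-1` [set 1] by [].
apply: closed_comp => [x _|]; last exact: closed_eq.
by apply: (@cvg_dotp E (nbhs x) _ id id x x); exact: cvg_id.
Qed.

Lemma coord_le_norm (n : nat) (x : 'rV[R]_n) i : `|x 0 i| <= `|x|.
Proof.
by rewrite [leRHS]/Num.Def.normr /= mx_normrE; apply/bigmax_geP; right => /=; exists (0, i).
Qed.

Lemma norm_le x e : 0 <= e -> (forall i, `|x 0 i| <= e) -> `|x| <= e.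
Proof.
move=> e0 xe; rewrite [leLHS]/Num.Def.normr /= mx_normrE; apply/bigmax_leP; split => //=.
by case=> i j _ /=; rewrite ord1.
Qed.

Lemma sphere_norm_le1 x : sphere R d x -> `|x| <= 1.
Proof.
move=> x1; apply: norm_le => // i.
rewrite -(@ler_pXn2r _ 2) ?nnegrE// expr1n -normrX ger0_norm ?sqr_ge0//.
have <- : dotp x x = 1 by [].
rewrite /dotp (bigD1 i)//= -expr2 lerDl sumr_ge0// => j _.
by rewrite -expr2 sqr_ge0.
Qed.

Lemma dotp_le_norm x y : `|dotp x y| <= d.+1%:R * (`|x| * `|y|).
Proof.
apply: le_trans (ler_norm_sum _ _ _) _.
rewrite mulr_natl -[leRHS](_ : \sum_(i < d.+1) (`|x| * `|y|) = _); last first.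
  by rewrite sumr_const card_ord.
by apply: ler_sum => i _; rewrite normrM ler_pM// coord_le_norm.
Qed.

Lemma sphere_dotp_le x y : sphere R d x -> `|dotp x y| <= d.+1%:R * `|y|.
Proof.
move=> /sphere_norm_le1 x1; apply: le_trans (dotp_le_norm _ _) _.
by rewrite ler_pM2l ?ltr0n// ler_piMl.
Qed.

Lemma sphere_compact : compact (sphere R d).
Proof.
apply: bounded_closed_compact sphere_closed; exists 1; split => // M M1 x.
by move/sphere_norm_le1/le_trans; apply; exact: ltW.
Qed.

Lemma sphere_dotp_le1 x y : sphere R d x -> sphere R d y -> -1 <= dotp x y <= 1.
Proof.
rewrite /sphere/= => x1 y1; have := dotpp_ge0 (x + y); have := dotpp_ge0 (x - y).
rewrite !(dotpDl, dotpDr, dotpNl, dotpNr) (dotpC y x) x1 y1; lra.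
Qed.

Lemma sphere_dotp_eqN1 x y : sphere R d x -> sphere R d y ->
  dotp x y = -1 -> x = - y.
Proof.
rewrite /sphere/= => x1 y1 xy; apply/eqP; rewrite -subr_eq0 opprK -dotpp_eq0.
by rewrite !(dotpDl, dotpDr) (dotpC y x) x1 y1 xy; apply/eqP; ring.
Qed.

Definition normalize x : E := (Num.sqrt (dotp x x))^-1 *: x.

Lemma sqrt_dotpp_gt0 x : x != 0 -> 0 < Num.sqrt (dotp x x).
Proof. by rewrite sqrtr_gt0 dotpp_gt0. Qed.

Lemma normalize_sphere x : x != 0 -> sphere R d (normalize x).
Proof.
move=> x0; rewrite /sphere/= /normalize dotpZl dotpZr mulrA -invfM -expr2.
by rewrite sqr_sqrtr ?dotpp_ge0// mulVf// dotpp_eq0.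
Qed.

Lemma normalize_id x : sphere R d x -> normalize x = x.
Proof. by rewrite /sphere/= /normalize => ->; rewrite sqrtr1 invr1 scale1r. Qed.

Lemma normalize_cvg x : x != 0 -> normalize y @[y --> x] --> normalize x.
Proof.
move=> x0; rewrite /normalize.
have cdot : dotp y y @[y --> x] --> dotp x x.
  by apply: (@cvg_dotp E (nbhs x) _ id id x x); exact: cvg_id.
have csqrt : Num.sqrt (dotp y y) @[y --> x] --> Num.sqrt (dotp x x).
  exact: (cvg_comp _ Num.sqrt cdot (@sqrt_continuous R _)).
apply: (@cvgZ _ _ _ (nbhs x) _ (fun y => (Num.sqrt (dotp y y))^-1) id).
  by apply: cvgV csqrt; rewrite gt_eqF// sqrt_dotpp_gt0.
exact: cvg_id.
Qed.

End Euclid.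

                                                

(** * Boundary parts of convex sets have Lebesgue measure zero *)

Section ThinSets.
Context {R : realType}.

Definition convex_subset n (C : set 'rV[R]_n) : Prop :=
  forall (v w : 'rV[R]_n) (t : R), 0 <= t <= 1 -> C v -> C w -> C ((1 - t) *: v + t *: w).

Definition inner n (C : set 'rV[R]_n) : set 'rV[R]_n :=
  [set v | exists2 e : R, 0 < e &
    forall w : 'rV[R]_n, (forall i, `|w 0 i - v 0 i| < e) -> C w].

Definition slice n (A : set 'rV[R]_n.+1) (x : R) : set 'rV[R]_n :=
  [set v | A (row_mx (x%:M : 'rV[R]_1) v)].

(** A point (z,w) near (x,v), on the side of y, is a convex combination of (y,u) and a point (x,w')
    of the slice at x, with weight s = (z-x)/(y-x) on (y,u). As s tends to 0, w' stays in the given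
    neighbourhood of v. *)
Lemma inner_slice_half n (C : set 'rV[R]_n.+1) (x y : R) (v u : 'rV[R]_n) :
  convex_subset C -> inner (slice C x) v -> slice C y u -> x != y ->
  exists2 e : R, 0 < e & forall (z : R) (w : 'rV[R]_n), 0 <= (z - x) / (y - x) -> `|z - x| < e ->
    (forall i, `|w 0 i - v 0 i| < e) -> slice C z w.
Proof.
move=> cC [e e0 Ce] Cu xy.
set D := `|y - x|; have D0 : 0 < D by rewrite normr_gt0 subr_eq0 eq_sym.
set M := `|v - u|; have M0 : 0 <= M by exact: normr_ge0.
(* The first bound gives s <= 1/2. The second gives |w - v| + s |v - u| < r (1 + M/D) <= e/2 <= e
   (1-s), that is |w' - v| < e. *)
pose r := Num.min (D / 2) (e / (2 * (1 + M / D))).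
have MD : 0 <= M / D by rewrite divr_ge0// ltW.
have r0 : 0 < r by rewrite lt_min !divr_gt0// mulr_gt0//; lra.
exists r => // z w s0 zr wr; set s := (z - x) / (y - x) in s0.
have sE : s = `|z - x| / D by rewrite -(ger0_norm s0) normf_div.
have s2 : s <= 2^-1.
  rewrite sE ler_pdivrMr// mulrC; apply: le_trans (ltW zr) _.
  by rewrite /r ge_min lexx.
have s1 : 0 < 1 - s by lra.
pose w' := (1 - s)^-1 *: (w - s *: u).
have wE : row_mx (z%:M : 'rV_1) w =
    (1 - s) *: row_mx (x%:M : 'rV_1) w' + s *: row_mx (y%:M : 'rV_1) u.
  rewrite !scale_row_mx add_row_mx !scale_scalar_mx -raddfD; congr row_mx.
    by congr (_%:M); rewrite /s; field; rewrite subr_eq0 eq_sym.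
  by rewrite scalerA mulfV ?gt_eqF// scale1r subrK.
rewrite /slice/= wE; apply: cC => //; first by apply/andP; split; lra.
apply: Ce => i; rewrite !mxE.
have -> : (1 - s)^-1 * (w 0 i - s * u 0 i) - v 0 i =
    (1 - s)^-1 * (w 0 i - v 0 i + s * (v 0 i - u 0 i)).
  by field; rewrite gt_eqF.
rewrite normrM gtr0_norm ?invr_gt0// mulrC ltr_pdivrMr//.
apply: le_lt_trans (ler_normD _ _) _; rewrite normrM (ger0_norm s0).
have vu : `|v 0 i - u 0 i| <= M by have := coord_le_norm (v - u) i; rewrite !mxE.
have : r <= e / (2 * (1 + M / D)) by rewrite /r ge_min lexx orbT.
rewrite ler_pdivlMr ?mulr_gt0//; last lra; move=> re.
have sr : s <= r / D by rewrite sE ler_pM2r ?invr_gt0// ltW.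
have smM : s * `|v 0 i - u 0 i| <= r * (M / D).
  rewrite [leRHS](_ : _ = r / D * M); last by ring.
  exact: ler_pM.
have wi := wr i.
have : e * 2^-1 <= e * (1 - s) by rewrite ler_pM2l//; lra.
move: re smM wi; set a := M / D; set b := _ * `|_|; set c := `|_|; lra.
Qed.

Lemma inner_slice n (C : set 'rV[R]_n.+1) (x y z : R) (v : 'rV[R]_n) :
  convex_subset C -> y < x < z -> slice C y !=set0 -> slice C z !=set0 ->
  inner (slice C x) v -> inner C (row_mx (x%:M : 'rV_1) v).
Proof.
move=> cC /andP[yx xz] [u Cu] [u' Cu'] Cv.
have [|e e0 Ce] := inner_slice_half cC Cv Cu; first by rewrite gt_eqF.
have [|e' e'0 Ce'] := inner_slice_half cC Cv Cu'; first by rewrite lt_eqF.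
exists (Num.min e e') => [|w wE]; first by rewrite lt_min e0.
pose t := w 0 (lshift n (0 : 'I_1)).
have -> : w = row_mx (t%:M : 'rV_1) (rsubmx (w : 'rV_(1 + n))).
  rewrite -[LHS](@hsubmxK _ 1 1 n) (_ : lsubmx _ = t%:M)//.
  by apply/rowP => i; rewrite !mxE ord1 eqxx mulr1n.
have tx : `|t - x| < Num.min e e'.
  by have := wE (lshift n (0 : 'I_1)); rewrite (@row_mxEl R 1 1 n) mxE eqxx mulr1n.
have wv i : `|rsubmx (w : 'rV_(1 + n)) 0 i - v 0 i| < Num.min e e'.
  by have := wE (rshift 1 i); rewrite (@row_mxEr R 1 1 n) mxE.
have [tlex|xltt] := leP t x.
  apply: Ce => [||i]; first by rewrite -divrNN divr_ge0; lra.
    by move: tx; rewrite lt_min => /andP[].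
  by move: (wv i); rewrite lt_min => /andP[].
apply: Ce' => [||i]; first by rewrite divr_ge0; lra.
  by move: tx; rewrite lt_min => /andP[].
by move: (wv i); rewrite lt_min => /andP[].
Qed.

(** Such an [f] is a case distinction on two points, hence measurable and almost everywhere zero. *)
Lemma integral_off_two_points (f : R -> \bar R) (x y : R) :
  (forall z, z != x -> z != y -> f z = 0%E) ->
  (\int[@lebesgue_measure R]_z f z = 0)%E.
Proof.
move=> f0.
have fE : f = (fun z => if z == x then f x else if z == y then f y else 0%E).
  by apply/funext => z; case: eqVneq => [->//|zx]; case: eqVneq => [->//|zy]; exact: f0.
have meq (t : R) : measurable_fun setT (fun z : measurableTypeR R => z == t).
  apply: (measurable_fun_bool true); rewrite setTI (_ : _ @^-1` _ = [set t]).
    exact: measurable_set1.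
  by apply/seteqP; split => z /= /eqP.
have mf : measurable_fun setT (f : measurableTypeR R -> \bar R).
  rewrite fE; apply: measurable_fun_ifT => //.
  by apply: measurable_fun_ifT.
rewrite (ae_eq_integral (cst 0%E))//; first by rewrite integral0.
exists ([set x] `|` [set y]); split.
- by apply: measurableU; exact: measurable_set1.
- by apply/eqP; rewrite measureU0//= ?lebesgue_measure_set1//; exact: measurable_set1.
- move=> z /= zf; apply: contrapT => /not_orP[/eqP zx /eqP zy]; apply: zf => _.
  exact: f0.
Qed.

                                                                               
                                                                                  
                                                                                
            
(** Induction on the dimension. Strictly between the extreme abscissae of C, an inner point of a
    slice is an inner point of C, so the slices of A are again thin in the slices of C. Only two
    abscissae remain. In dimension 0 every point of C is inner. *)
Lemma lebesgue_rV_thin n (C A : set 'rV[R]_n) :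
  convex_subset C -> (forall v, A v -> C v /\ ~ inner C v) ->
  lebesgue_rV A = 0%E.
Proof.
elim: n C A => [|n IHn] C A cC AC /=.
  rewrite indicE memNset// => /AC[C0 []]; exists 1 => // w _.
  by rewrite (_ : w = 0)//; apply/rowP => -[].
pose Pr := [set x | slice C x !=set0].
pose top x := Pr x /\ forall y, Pr y -> y <= x.
pose bot x := Pr x /\ forall y, Pr y -> x <= y.
(* The extreme abscissae of C, when attained; the default 0 merely excludes one more point. *)
apply: (integral_off_two_points (x := xget 0 top) (y := xget 0 bot)) => x xtop xbot.
apply: (IHn (slice C x)) => [v w t t01 Cv Cw|v Av].
  have vwE : row_mx (x%:M : 'rV_1) ((1 - t) *: v + t *: w) =
      (1 - t) *: row_mx (x%:M : 'rV_1) v + t *: row_mx (x%:M : 'rV_1) w.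
    rewrite !scale_row_mx add_row_mx !scale_scalar_mx -raddfD; congr row_mx.
    by congr (_%:M); ring.
  by rewrite /slice/= vwE; exact: cC.
have [Cv NCv] := AC _ Av; split => // Iv; apply: NCv.
have Prx : Pr x by exists v.
have [y Pry yx] : exists2 y, Pr y & y < x.
  apply: contrapT => Ny; case/eqP: xbot; apply/esym.
  have botx : bot x.
    by split => // y Py; rewrite leNgt; apply/negP => yx; apply: Ny; exists y.
  case: xgetP => [y _ [Pry boty]|]; last by move/(_ x).
  by apply/eqP; rewrite eq_le boty// botx.2.
have [z Prz xz] : exists2 y, Pr y & x < y.
  apply: contrapT => Ny; case/eqP: xtop; apply/esym.
  have topx : top x.
    by split => // z Pz; rewrite leNgt; apply/negP => zx; apply: Ny; exists z.
  case: xgetP => [z _ [Prz topz]|]; last by move/(_ x).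
  by apply/eqP; rewrite eq_le topz// topx.2.
by apply: (@inner_slice _ C x y z) => //; rewrite yx.
Qed.

End ThinSets.

                                                         

(** * Properties of the spherical measure from void probabilities *)

Section VoidProbabilities.
Context {R : realType} {d : nat}.
Local Notation E := 'rV[R]_d.+1.
Implicit Types (A B : set E).

Lemma counts_eq0 (s : seq E) A : counts s A = 0%N <-> forall x, x \in s -> ~ A x.
Proof.
rewrite /counts; split => [c0 x xs Ax|sA].
  have : has (fun x => x \in A) s by apply/hasP; exists x => //; rewrite inE.
  by rewrite has_count c0.
apply/eqP; rewrite -leqn0 leqNgt -has_count; apply/hasP => -[x xs].
by rewrite inE => /(sA _ xs).
Qed.

Definition mu A : R := fine (sigma A).

                                                                           
                                                                           
                                               

Context {dO : measure_display} {Omega : measurableType dO}.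
Context {P : probability Omega R} {g : R} {X : Omega -> seq E}.
Hypothesis g_gt0 : 0 < g.
Hypothesis ppX : poisson_process P g X.

(** Since P(void A) = exp(-g mu(A)), inclusions and limits of void events turn into inequalities and
    limits for [mu]. This replaces a study of the iterated integral. *)
Definition void A : set Omega := [set w | counts (X w) A = 0%N].

Lemma measurable_void A : borel_set A -> measurable (void A).
Proof. by move=> mA; exact: (pp_measurable ppX). Qed.

Lemma void_prob A : borel_set A -> P (void A) = (expR (- (g * mu A)))%:E.
Proof.
by move=> mA; have := pp_poisson ppX 0 mA; rewrite /= expr0 fact0 divr1 mul1r.
Qed.

Lemma mu_ge0 A : borel_set A -> 0 <= mu A.
Proof.
move=> mA; have := @probability_le1 _ _ _ P _ (measurable_void mA).
rewrite void_prob// lee_fin -[leRHS]expR0 ler_expR oppr_le0.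
by rewrite pmulr_rge0.
Qed.

(** T is almost surely free of points, so up to a null event an empty B forces an empty A. *)
Lemma mu_le_null A B T : borel_set A -> borel_set B -> borel_set T ->
  A `<=` B `|` T -> mu T = 0 -> mu A <= mu B.
Proof.
move=> mA mB mT ABT T0.
have PT : P (~` void T) = 0%E.
  rewrite probability_setC ?void_prob//; last exact: measurable_void.
  by rewrite T0 mulr0 oppr0 expR0 subee.
have : (P (void B) <= P (void A `|` ~` void T))%E.
  apply: le_measure; rewrite ?inE; first exact: measurable_void.
    by apply: measurableU; [exact: measurable_void|apply: measurableC; exact: measurable_void].
  move=> w /counts_eq0 wB; have [wT|] := pselect (void T w); last by right.
  left; apply/counts_eq0 => x xX /ABT[/wB|]; first exact.
  by move/counts_eq0: wT; exact.
have mT' := measurableC (measurable_void mT).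
move=> BAT; have : (P (void B) <= P (void A) + P (~` void T))%E.
  by apply: le_trans BAT (measureU2 _ _ _) => //; exact: measurable_void.
rewrite PT adde0.
by rewrite !void_prob// lee_fin ler_expR lerN2 ler_pM2l.
Qed.

Lemma le_mu A B : borel_set A -> borel_set B -> A `<=` B -> mu A <= mu B.
Proof.
move=> mA mB AB; rewrite -(ler_pM2l g_gt0) -lerN2 -ler_expR -lee_fin -!void_prob//.
apply: le_measure; rewrite ?inE; [exact: measurable_void..|].
by move=> w /counts_eq0 wB; apply/counts_eq0 => x /wB + /AB.
Qed.

(** The void event of the union is the decreasing intersection of the void events; P is continuous
    from above. *)
Lemma mu_bigcup (F : nat -> set E) (e : R) : (forall n, borel_set (F n)) ->
  {homo F : n m / (n <= m)%N >-> n `<=` m} -> 0 < e ->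
  exists n, mu (\bigcup_n F n) < mu (F n) + e.
Proof.
move=> mF ndF e0.
have mU : borel_set (\bigcup_n F n) by apply: bigcupT_measurable.
have capE : \bigcap_n void (F n) = void (\bigcup_n F n).
  apply/seteqP; split => w wF.
    by apply/counts_eq0 => x xX [n _ Fnx]; have /counts_eq0/(_ x xX) := wF n I; exact.
  move=> n _; apply/counts_eq0 => x xX Fnx.
  by have /counts_eq0/(_ x xX) := wF; apply; exists n.
have cvgP : (P \o (void \o F)) n @[n --> \oo] --> P (void (\bigcup_n F n)).
  rewrite -capE; apply: nonincreasing_cvg_mu.
  - by rewrite (le_lt_trans (probability_le1 _ _)) ?ltry//; exact: measurable_void.
  - by move=> n; exact: measurable_void.
  - by rewrite capE; exact: measurable_void.
  - move=> n m nm; apply/subsetPset => w /counts_eq0 wF; apply/counts_eq0 => x xX.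
    by move=> /(ndF _ _ nm); exact: wF.
have {}cvgP : expR (- (g * mu (F n))) @[n --> \oo] -->
    expR (- (g * mu (\bigcup_n F n))).
  rewrite void_prob// in cvgP; apply: (fine_cvg (f := fun n => (expR _)%:E)).
  by apply: cvg_trans cvgP; apply: near_eq_cvg; near=> n; rewrite /= void_prob.
have : expR (- (g * mu (\bigcup_n F n))) < expR (- (g * (mu (\bigcup_n F n) - e))).
  by rewrite ltr_expR ltrN2 ltr_pM2l// gtrBl.
move=> /(cvgr_lt _ cvgP)/filter_ex[n]; rewrite ltr_expR ltrN2 ltr_pM2l// ltrBlDr.
by exists n.
Unshelve. all: by end_near. Qed.

(** A realization is a finite list: if each of its points leaves some F n, then all have left one
    common F n. So the void event of the intersection is the increasing union of the void events. *)
Lemma mu_bigcap (F : nat -> set E) (e : R) : (forall n, borel_set (F n)) ->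
  {homo F : n m / (n <= m)%N >-> m `<=` n} -> 0 < e ->
  exists n, mu (F n) < mu (\bigcap_n F n) + e.
Proof.
move=> mF niF e0.
have mI : borel_set (\bigcap_n F n) by apply: bigcapT_measurable.
have cupE : \bigcup_n void (F n) = void (\bigcap_n F n).
  apply/seteqP; split => [w [n _ /counts_eq0 wF]|w /counts_eq0 wF].
    by apply/counts_eq0 => x /wF nFx /(_ n I).
  suff [n Fn] : exists n, forall x, x \in X w -> ~ F n x.
    by exists n => //; apply/counts_eq0.
  elim: (X w) wF => [|x s IHs] sF; first by exists 0%N.
  have [|n sFn] := IHs; first by move=> y ys; apply: sF; rewrite inE ys orbT.
  have [m xFm] : exists m, ~ F m x.
    apply: contrapT => xF; apply: (sF x (mem_head _ _)) => m _.
    by apply: contrapT => Fmx; apply: xF; exists m.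
  exists (maxn n m) => y; rewrite inE => /orP[/eqP-> /(niF m)|/sFn yFn /(niF n)].
    by move=> Fmx; apply/xFm/Fmx/leq_maxr.
  by move=> Fny; apply/yFn/Fny/leq_maxl.
have cvgP : (P \o (void \o F)) n @[n --> \oo] --> P (void (\bigcap_n F n)).
  rewrite -cupE; apply: nondecreasing_cvg_mu.
  - by move=> n; exact: measurable_void.
  - by rewrite cupE; exact: measurable_void.
  - move=> n m nm; apply/subsetPset => w /counts_eq0 wF; apply/counts_eq0 => x xX.
    by move=> /(niF _ _ nm); exact: wF.
have {}cvgP : expR (- (g * mu (F n))) @[n --> \oo] -->
    expR (- (g * mu (\bigcap_n F n))).
  rewrite void_prob// in cvgP; apply: (fine_cvg (f := fun n => (expR _)%:E)).
  by apply: cvg_trans cvgP; apply: near_eq_cvg; near=> n; rewrite /= void_prob.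
have : expR (- (g * (mu (\bigcap_n F n) + e))) < expR (- (g * mu (\bigcap_n F n))).
  by rewrite ltr_expR ltrN2 ltr_pM2l// ltrDl.
move=> /(cvgr_gt _ cvgP)/filter_ex[n]; rewrite ltr_expR ltrN2 ltr_pM2l//.
by exists n.
Unshelve. all: by end_near. Qed.

End VoidProbabilities.

                                                   

(** * Closed convex cones and convex bodies *)

Section ConvexCones.
Context {R : realType} {d : nat}.
Local Notation E := 'rV[R]_d.+1.
Implicit Types (C K L : set E) (x y z u v w : E).

Lemma cone_scale C x (t : R) : closed_convex_cone C -> 0 <= t -> C x -> C (t *: x).
Proof.
by move=> [_ C0 CC] t0 Cx; have := CC t 0 x 0 t0 (lexx _) Cx C0; rewrite scaler0 addr0.
Qed.

Lemma cone_add C x y : closed_convex_cone C -> C x -> C y -> C (x + y).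
Proof.
by move=> [_ C0 CC] Cx Cy; have := CC 1 1 x y ler01 ler01 Cx Cy; rewrite !scale1r.
Qed.

Lemma cone_no_opposite C : closed_convex_cone C -> ~ linear_subspace C ->
  exists2 v, C v & ~ C (- v).
Proof.
move=> cC; apply: contra_notP => /forall2NP CN.
have {}CN v : C v -> C (- v) by move=> Cv; have [//|/contrapT] := CN v.
have CZ (t : R) v : C v -> C (t *: v).
  move=> Cv; have [t0|t0] := leP 0 t; first exact: cone_scale.
  have tN : 0 <= - t by rewrite oppr_ge0 ltW.
  by rewrite -[t]opprK scaleNr; apply/CN/(cone_scale cC tN).
(* If C = -C, take a subspace of maximal dimension inside C. Adding the line through any x in C
   keeps it inside C, so it already contains x. *)
pose P n := `[< exists2 U : {vspace E}, (\dim U = n)%N & [set x | x \in U] `<=` C >].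
have P0 : exists n, P n.
  exists 0%N; apply/asboolP; exists 0%VS; first by rewrite dimv0.
  by move=> x /=; rewrite memv0 => /eqP ->; case: cC.
have Pmax n : P n -> (n <= \dim {:E})%N.
  by move=> /asboolP[U <- _]; apply/dimvS/subvf.
have [n /asboolP[U dU UC] nmax] := ex_maxnP P0 Pmax.
exists U; apply/seteqP; split => // x Cx /=.
have : P (\dim (U + <[x]>)%VS).
  apply/asboolP; exists (U + <[x]>)%VS => // _ /memv_addP[y yU [z /vlineP[t ->] ->]].
  by apply: cone_add => //; [exact: UC|exact: CZ].
move/nmax; rewrite -dU => dle.
have /eqP -> : (U == U + <[x]>)%VS by rewrite eqEdim addvSl.
by apply: subvP (addvSr _ _) _ _; exact: memv_line.
Qed.

                                                                            
                                                            
(** Take v in C with -v outside C, and let p be the point of C nearest to -v. Then v + p lies in C,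
    is nonzero, and the minimality of p makes it nonnegative on C; [u] is its normalization. That
    [u] belongs to C is what later keeps limits of cones from being linear. *)
Lemma cone_inner_support C : closed_convex_cone C -> ~ linear_subspace C ->
  exists u, [/\ sphere R d u, C u & forall z, C z -> 0 <= dotp u z].
Proof.
move=> cC nC; have [v Cv NCv] := cone_no_opposite cC nC.
have [clC C0 CC] := cC.
pose q z := dotp (v + z) (v + z).
have cq : continuous q.
  have cv z : (fun z => v + z) @ z --> v + z.
    by apply: (@cvgD R E E (nbhs z) _ (fun=> v) id v z); [exact: cvg_cst|exact: cvg_id].
  by move=> z; have := cvg_dotp (cv z) (cv z); exact.
pose B := C `&` [set z | q z <= q 0].
have B0 : B !=set0 by exists 0; split => /=; [|exact: lexx].
have cB : compact B.
  apply: bounded_closed_compact; last first.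
    apply: closedI => //; apply: (@closed_comp _ _ q [set t | t <= q 0]) => [z _|].
      exact: cq.
    exact: closed_le.
  exists (1 + q 0 + `|v|); split; first exact: num_real.
  move=> M vM z [_ zB]; apply: norm_le => [|i].
    by rewrite (le_trans _ (ltW vM))// !addr_ge0// /q dotpp_ge0.
  have : `|(v + z) 0 i| <= 1 + q 0.
    have sq : (v + z) 0 i ^+ 2 <= q 0.
      apply: le_trans zB; rewrite /q /dotp (bigD1 i)//= -expr2 lerDl sumr_ge0// => j _.
      by rewrite -expr2 sqr_ge0.
    rewrite -(@ler_pXn2r _ 2) ?nnegrE ?addr_ge0 ?dotpp_ge0// -normrX ger0_norm ?sqr_ge0//.
    apply: le_trans sq _; have : 0 <= q 0 by exact: dotpp_ge0.
    by set b := q 0; nra.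
  rewrite mxE => vz; have := coord_le_norm v i.
  have := ler_normB (v 0 i + z 0 i) (v 0 i); rewrite addrC addKr.
  by move: vM vz; set a := q 0; lra.
have [p] := compact_EVT_min B0 cB (continuous_subspaceT cq).
rewrite inE => -[Cp pB] pmin.
have {}pmin z : C z -> q p <= q z.
  move=> Cz; have [zB|/ltW] := leP (q z) (q 0); first by apply: pmin; rewrite inE.
  exact: le_trans.
have w0 : v + p != 0.
  by apply: contra_not_neq NCv => /eqP; rewrite addr_eq0 => /eqP ->; rewrite opprK.
have Cw : C (v + p) by exact: cone_add.
have wge0 z : C z -> 0 <= dotp (v + p) z.
  move=> Cz; rewrite leNgt; apply/negP => wz.
  have z0 : 0 < dotp z z.
    by rewrite dotpp_gt0; apply: contraTneq wz => ->; rewrite dotp0 ltxx.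
  (* The minimizer of |v + p + t z|^2 over t; a negative product would contradict the choice of
     p. *)
  pose t := - dotp (v + p) z / dotp z z.
  have t0 : 0 < t by rewrite divr_gt0// oppr_gt0.
  have := pmin _ (cone_add cC Cp (cone_scale cC (ltW t0) Cz)).
  rewrite /q addrA (dotp_sqrD (v + p)) dotpZl !dotpZr.
  have -> : t * dotp z z = - dotp (v + p) z by rewrite /t divfK// gt_eqF.
  by nra.
exists (normalize (v + p)); split; first exact: normalize_sphere.
  by apply: cone_scale => //; rewrite invr_ge0 sqrtr_ge0.
by move=> z Cz; rewrite dotpZl mulr_ge0 ?invr_ge0 ?sqrtr_ge0 ?wge0.
Qed.

Definition cone K : set E := [set z | exists t x, [/\ 0 <= t, K x & z = t *: x]].

(** The defining cone can be recovered from the body. For the origin this needs a unit vector in C,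
    provided by the inner support. *)
Lemma cone_body C : closed_convex_cone C -> ~ linear_subspace C ->
  cone (sphere R d `&` C) = C.
Proof.
move=> cC nC; apply/seteqP; split => [_ [t [x [t0 [_ Cx] ->]]]|z Cz].
  exact: cone_scale.
have [->|z0] := eqVneq z 0.
  have [u [Su Cu _]] := cone_inner_support cC nC.
  by exists 0, u; rewrite scale0r.
exists (Num.sqrt (dotp z z)), (normalize z); split; first exact: sqrtr_ge0.
  split; first exact: normalize_sphere.
  by apply: cone_scale => //; rewrite invr_ge0 sqrtr_ge0.
by rewrite scalerA mulfV ?scale1r// gt_eqF// sqrt_dotpp_gt0.
Qed.

Lemma convex_body_sub K : convex_body R d K -> K `<=` sphere R d.
Proof. by move=> [C [_ _ ->]] x []. Qed.

Lemma convex_body_nonempty K : convex_body R d K -> K !=set0.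
Proof.
by move=> [C [cC nC ->]]; have [u [Su Cu _]] := cone_inner_support cC nC; exists u.
Qed.

Lemma convex_body_closed K : convex_body R d K -> closed K.
Proof. by move=> [C [[clC _ _] _ ->]]; apply: closedI => //; exact: sphere_closed. Qed.

Lemma convex_body_compact K : convex_body R d K -> compact K.
Proof.
move=> bK; apply: subclosed_compact (convex_body_sub bK); last exact: sphere_compact.
exact: convex_body_closed.
Qed.

Lemma convex_bodyP K : convex_body R d K ->
  [/\ closed_convex_cone (cone K), ~ linear_subspace (cone K) & K = sphere R d `&` cone K].
Proof. by move=> [C [cC nC ->]]; rewrite cone_body. Qed.

End ConvexCones.

(** * Spherical Hausdorff distance against norm closeness *)

Section HausdorffDistance.
Context {R : realType} {d : nat}.
Local Notation E := 'rV[R]_d.+1.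
Implicit Types (K L : set E) (x y : E) (r e : R).

Lemma sdist_ge0 x y : sphere R d x -> sphere R d y -> 0 <= sdist x y.
Proof. by move=> Sx Sy; apply/acos_ge0/sphere_dotp_le1. Qed.

Lemma sdist_lepi x y : sphere R d x -> sphere R d y -> sdist x y <= pi.
Proof. by move=> Sx Sy; apply/acos_lepi/sphere_dotp_le1. Qed.

Lemma sdist_lt x y r : sphere R d x -> sphere R d y -> 0 <= r <= pi ->
  (sdist x y < r) = (cos r < dotp x y).
Proof.
move=> Sx Sy r0pi; rewrite -[in RHS](@acosK _ (dotp x y)); last first.
  by rewrite in_itv/= sphere_dotp_le1.
by rewrite ltr_cos ?in_itv//= sdist_ge0 ?sdist_lepi.
Qed.

Lemma sphere_dist2 x y : sphere R d x -> sphere R d y ->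
  dotp (x - y) (x - y) = 2 * (1 - dotp x y).
Proof.
rewrite /sphere/= => Sx Sy; rewrite dotp_sqrD !(dotpNl, dotpNr) Sx Sy; ring.
Qed.

Lemma norm_sdist e : 0 < e -> exists2 r, 0 < r &
  forall x y, sphere R d x -> sphere R d y -> sdist x y < r -> `|x - y| < e.
Proof.
(* For unit vectors |x - y|^2 = 2 (1 - cos(sdist x y)), and 2c < e^2; the cap 1 keeps 1 - c in the
   domain of acos. *)
move=> e0; pose c : R := Num.min (e ^+ 2 / 3) 1.
have e20 : 0 < e ^+ 2 by rewrite exprn_gt0.
have c0 : 0 < c by rewrite lt_min ltr01 andbT divr_gt0.
have c1 : c <= 1 by rewrite /c ge_min lexx orbT.
have c_itv : -1 <= 1 - c <= 1 by apply/andP; split; lra.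
have r0 : 0 < acos (1 - c) by apply: acos_gt0; apply/andP; split; lra.
exists (acos (1 - c)) => // x y Sx Sy.
rewrite sdist_lt ?acos_lepi ?(ltW r0)// acosK ?in_itv//= => xy.
apply: le_lt_trans (norm_le (e := Num.sqrt (dotp (x - y) (x - y))) _ _) _.
- exact: sqrtr_ge0.
- move=> i; rewrite -sqrtr_sqr ler_wsqrtr// /dotp (bigD1 i)//= -expr2.
  by rewrite lerDl sumr_ge0// => j _; rewrite -expr2 sqr_ge0.
- rewrite -[ltRHS]ger0_norm ?(ltW e0)// -sqrtr_sqr ltr_sqrt// sphere_dist2//.
  have : c <= e ^+ 2 / 3 by rewrite /c ge_min lexx.
  lra.
Qed.

Lemma sdist_norm r : 0 < r -> exists2 e, 0 < e &
  forall x y, sphere R d x -> sphere R d y -> `|x - y| < e -> sdist x y < r.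
Proof.
move=> r0; pose s := Num.min r pi.
have s0 : 0 < s by rewrite lt_min r0 pi_gt0.
have spi : s <= pi by rewrite /s ge_min lexx orbT.
have cs : 0 < 1 - cos s.
  by rewrite subr_gt0 -[ltRHS]cos0 ltr_cos ?in_itv/= ?lexx ?pi_ge0 ?spi ?(ltW s0).
exists (Num.min 1 ((1 - cos s) / d.+1%:R)) => [|x y Sx Sy].
  by rewrite lt_min ltr01 divr_gt0.
rewrite lt_min => /andP[xy1]; rewrite ltr_pdivlMr// => xy2.
apply: (@lt_le_trans _ _ s); last by rewrite /s ge_min lexx.
rewrite sdist_lt ?spi ?(ltW s0)//.
have := dotp_le_norm (x - y) (x - y); rewrite sphere_dist2//.
have D0 : 0 < d.+1%:R :> R by rewrite ltr0n.
have n0 : 0 <= `|x - y| by [].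
move=> /(le_trans (ler_norm _)).
have : d.+1%:R * (`|x - y| * `|x - y|) <= `|x - y| * d.+1%:R.
  by rewrite mulrC ler_pM2r// ler_piMl// ltW.
lra.
Qed.

Lemma sdist_setE_le x y L r : sphere R d x -> L `<=` sphere R d -> L y ->
  sdist x y <= r -> sdist_set x L <= r.
Proof.
move=> Sx LS Ly; apply: le_trans; apply: ge_inf; last by exists y.
by exists 0 => _ [z Lz <-]; apply: sdist_ge0 => //; exact: LS.
Qed.

Lemma hausdorff_dist_le K L r : K `<=` sphere R d -> L `<=` sphere R d ->
  K !=set0 -> L !=set0 ->
  (forall x, K x -> exists2 y, L y & sdist x y <= r) ->
  (forall y, L y -> exists2 x, K x & sdist x y <= r) ->
  hausdorff_dist K L <= r.
Proof.
move=> KS LS [x0 Kx0] [y0 Ly0] KL LK; rewrite /hausdorff_dist ge_max.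
apply/andP; split; apply: ge_sup.
- by exists (sdist_set x0 L), x0.
- move=> _ [x Kx <-]; have [y Ly xy] := KL _ Kx.
  by apply: sdist_setE_le xy => //; exact: KS.
- by exists (sdist_set y0 K), y0.
- move=> _ [y Ly <-]; have [x Kx xy] := LK _ Ly.
  by apply: (@sdist_setE_le _ x) => //; [exact: LS|rewrite /sdist dotpC].
Qed.

Lemma sdist_set_lt_sup K L x r : K `<=` sphere R d -> L `<=` sphere R d ->
  L !=set0 -> K x -> sup [set sdist_set x L | x in K] < r ->
  exists2 y, L y & sdist x y < r.
Proof.
move=> KS LS [y0 Ly0] Kx supr.
have xLr : sdist_set x L < r.
  apply: le_lt_trans supr; apply: ub_le_sup; last by exists x.
  exists pi => _ [z Kz <-]; apply: (@sdist_setE_le _ y0) => //; first exact: KS.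
  by apply: sdist_lepi; [exact: KS|exact: LS].
have [] := @inf_adherent _ [set sdist x y | y in L] (r - sdist_set x L).
- by rewrite subr_gt0.
- split; first by exists (sdist x y0), y0.
  by exists 0 => _ [z Lz <-]; apply: sdist_ge0; [exact: KS|exact: LS].
- by move=> _ [y Ly <-]; rewrite addrC subrK => xy; exists y.
Qed.

(** Hausdorff closeness in the sup norm, free of infima, suprema and arc lengths. The two lemmas
    that follow show that it describes the same small neighbourhoods of nonempty subsets of the
    sphere. *)
Definition close_sets e K L : Prop :=
  (forall x, K x -> exists2 y, L y & `|x - y| < e) /\
  (forall y, L y -> exists2 x, K x & `|x - y| < e).

Lemma hausdorff_close e : 0 < e -> exists2 r, 0 < r &
  forall K L, K `<=` sphere R d -> L `<=` sphere R d -> K !=set0 -> L !=set0 ->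
    hausdorff_dist K L < r -> close_sets e K L.
Proof.
move=> /norm_sdist[r r0 re]; exists r => // K L KS LS K0 L0.
rewrite /hausdorff_dist gt_max => /andP[KL LK]; split => [x Kx|y Ly].
  have [y Ly xy] := sdist_set_lt_sup KS LS L0 Kx KL.
  by exists y => //; apply: re => //; [exact: KS|exact: LS].
have [x Kx yx] := sdist_set_lt_sup LS KS K0 Ly LK.
by exists x => //; rewrite distrC; apply: re => //; [exact: LS|exact: KS].
Qed.

Lemma close_hausdorff r : 0 < r -> exists2 e, 0 < e &
  forall K L, K `<=` sphere R d -> L `<=` sphere R d -> K !=set0 -> L !=set0 ->
    close_sets e K L -> hausdorff_dist K L < r.
Proof.
(* Half of r, because passing to suprema turns strict bounds into weak ones. *)
move=> r0; have [|e e0 er] := @sdist_norm (r / 2); first by rewrite divr_gt0.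
exists e => // K L KS LS K0 L0 [KL LK].
apply: (@le_lt_trans _ _ (r / 2)); last lra.
apply: hausdorff_dist_le => // [x Kx|y Ly].
  by have [y Ly xy] := KL _ Kx; exists y => //; apply/ltW/er => //; [exact: KS|exact: LS].
by have [x Kx xy] := LK _ Ly; exists x => //; apply/ltW/er => //; [exact: KS|exact: LS].
Qed.

End HausdorffDistance.

                                       

(** * Compactness of the space of convex bodies *)

Section UltraLimit.
Context {R : realType} {d : nat}.
Local Notation E := 'rV[R]_d.+1.
Implicit Types (C K L : set E) (x y z u v w : E) (e : R).

Variable U : set_system (set E).
Context {UU : UltraFilter U}.
Hypothesis Ubody : U (convex_body R d).

                                                     
(** The limit of the cones over [L] along the ultrafilter [U]: all points approximated by them to
    any accuracy. *)
Definition limit_cone : set E :=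
  [set z | forall e, 0 < e -> U [set L | exists2 w, cone L w & `|z - w| < e]].

Lemma limit_cone_closed : closed limit_cone.
Proof.
move=> z zcl e e0; have e20 : 0 < e / 2 by rewrite divr_gt0.
have [w [wl zw]] := zcl _ (nbhsx_ballx z (e / 2) e20).
move: zw; rewrite -ball_normE/= => zw.
apply: filterS (wl _ e20) => L [v Lv wv]; exists v => //.
by apply: le_lt_trans (ler_distD w _ _) _; lra.
Qed.

Lemma limit_cone_convex : closed_convex_cone limit_cone.
Proof.
split; first exact: limit_cone_closed.
  move=> e e0; apply: filterS Ubody => L bL; exists 0; last by rewrite subrr normr0.
  by have [[_ C0 _] _ _] := convex_bodyP bL.
move=> s t x y s0 t0 xl yl e e0.
have D0 : 0 < 2 * (s + t + 1) by lra.
have e'0 : 0 < e / (2 * (s + t + 1)) by rewrite divr_gt0.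
apply: filterS3 Ubody (xl _ e'0) (yl _ e'0) => L bL [v Lv xv] [w Lw yw].
exists (s *: v + t *: w).
  by have [[_ _ CC] _ _] := convex_bodyP bL; apply: CC.
rewrite opprD addrACA -!scalerBr; apply: le_lt_trans (ler_normD _ _) _.
rewrite !normrZ !ger0_norm//.
move: xv yw; rewrite !ltr_pdivlMr//; set a := `|_|; set b := `|_| => xv yw.
have a0 : 0 <= a := normr_ge0 _; have b0 : 0 <= b := normr_ge0 _.
nra.
Qed.

(** Along an ultrafilter, a cluster point of a map into a compact set is a limit. *)
Lemma ultra_select (f : set E -> E) (S : set E) : compact S -> U [set L | S (f L)] ->
  exists2 z, S z & forall e, 0 < e -> U [set L | `|z - f L| < e].
Proof.
move=> cS Sf; have FF : ProperFilter (f @ U) by exact: fmap_proper_filter.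
have [z [Sz zcl]] := cS (f @ U) FF Sf; exists z => // e e0.
have [//|NU] := in_ultra_setVsetC [set L | `|z - f L| < e] UU.
have [w [/= Nw]] := zcl [set w | ~ `|z - w| < e] _ NU (nbhsx_ballx z e e0).
by rewrite -ball_normE.
Qed.

Lemma limit_point (f : set E -> E) : U [set L | L (f L)] ->
  exists2 z, (sphere R d `&` limit_cone) z & forall e, 0 < e -> U [set L | `|z - f L| < e].
Proof.
move=> Uf; have [|z Sz zlim] := @ultra_select f _ sphere_compact.
  by apply: filterS2 Ubody Uf => L /convex_body_sub; exact.
exists z => //; split => // e e0.
apply: filterS2 Uf (zlim e e0) => L Lf zf; exists (f L) => //.
by exists 1, (f L); split; rewrite ?ler01 ?scale1r.
Qed.

(** The inner supports u(L) converge to some z in the limit cone. If the cone were linear, -z would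
    be a limit of points w of the cones over L, and the product of u(L) and w, close to -1, would be
    negative. *)
Lemma limit_cone_not_linear : ~ linear_subspace limit_cone.
Proof.
have /choice[u uP] : forall L, exists u, convex_body R d L ->
    L u /\ forall z, cone L z -> 0 <= dotp u z.
  move=> L; have [/convex_bodyP[cL nL ->]|] := pselect (convex_body R d L); last by exists 0.
  have [u [Su Cu uge0]] := cone_inner_support cL nL; exists u => _; split => //.
  by rewrite cone_body.
have [|z [Sz zl] zlim] := @limit_point u.
  by apply: filterS Ubody => L /uP[].
move=> [V VE]; have zNl : limit_cone (- z).
  by rewrite VE /= memvN; move: zl; rewrite VE.
have cont : (fun p : E * E => dotp p.1 p.2) @ ((z, - z) : E * E) --> dotp z (- z).
  by apply: cvg_dotp; [exact: cvg_fst|exact: cvg_snd].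
have zz : dotp z (- z) < 0 by rewrite dotpNr oppr_lt0 [dotp z z]Sz.
have [[A B] /= [/nbhs_ballP[a a0 zA] /nbhs_ballP[b b0 zB]] AB] := cvgr_lt _ cont _ zz.
have [L [bL [zu [w Lw zw]]]] := filter_ex (filterI Ubody (filterI (zlim _ a0) (zNl _ b0))).
have : dotp (u L) w < 0.
  by apply: (AB (u L, w)); split => /=; [apply: zA|apply: zB]; rewrite -ball_normE.
by rewrite ltNge (uP L bL).2.
Qed.

Definition limit_body : set E := sphere R d `&` limit_cone.

Lemma limit_body_convex : convex_body R d limit_body.
Proof.
exists limit_cone; split => //; [exact: limit_cone_convex|exact: limit_cone_not_linear].
Qed.

Lemma normalize_near z e : sphere R d z -> 0 < e ->
  exists2 r, 0 < r & forall w, `|z - w| < r -> w != 0 /\ `|z - normalize w| < e.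
Proof.
move=> Sz e0; have := normalize_cvg (sphere_neq0 Sz); rewrite normalize_id//.
move=> /(_ _ (nbhsx_ballx z e e0)) /nbhs_ballP[r r0 zr].
exists (Num.min r `|z|); first by rewrite lt_min normr_gt0 sphere_neq0// andbT.
move=> w; rewrite lt_min => /andP[zwr zw]; split.
  by apply: contraTneq zw => ->; rewrite subr0 ltxx.
by have := zr w; rewrite -!ball_normE/=; exact.
Qed.

(** If one half of the closeness failed, it would fail on a set of the ultrafilter. A witness chosen
    for each such L has a limit in the limit body, and bodies L near that limit contradict the
    choice. *)
Lemma limit_body_close e : 0 < e -> U [set L | close_sets e limit_body L].
Proof.
move=> e0; have e20 : 0 < e / 2 by rewrite divr_gt0.
apply: filterI.
  have [//|NU] := in_ultra_setVsetC [set L | forall x, limit_body x ->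
    exists2 y, L y & `|x - y| < e] UU; exfalso.
  have /choice[g gP] : forall L, exists x, ~ (forall x, limit_body x ->
      exists2 y, L y & `|x - y| < e) -> limit_body x /\ forall y, L y -> e <= `|x - y|.
    move=> L; have [H|NL] := pselect (forall x, limit_body x ->
      exists2 y, L y & `|x - y| < e); first by exists 0.
    apply: contrapT => N; apply: NL => x lx; apply: contrapT => Ny; apply: N; exists x.
    move=> _; split => // y Ly; rewrite leNgt; apply/negP => xy.
    by apply: Ny; exists y.
  have [|z zl zlim] := @ultra_select g limit_body (convex_body_compact limit_body_convex).
    by apply: filterS NU => L /gP[].
  have [r r0 rP] := normalize_near zl.1 e20.
  have [L [[bL NL] [zg [w Lw zw]]]] :=
    filter_ex (filterI (filterI Ubody NU) (filterI (zlim _ e20) (zl.2 _ r0))).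
  have [w0 znw] := rP _ zw.
  have [cL _ LE] := convex_bodyP bL.
  have Lnw : L (normalize w).
    rewrite LE; split; first exact: normalize_sphere.
    by apply: cone_scale => //; rewrite invr_ge0 sqrtr_ge0.
  have := (gP _ NL).2 _ Lnw; rewrite leNgt => /negP; apply.
  apply: le_lt_trans (ler_distD z _ _) _; rewrite (distrC _ z).
  by move: zg => /=; lra.
have [//|NU] := in_ultra_setVsetC [set L | forall y, L y ->
  exists2 x, limit_body x & `|x - y| < e] UU; exfalso.
have /choice[f fP] : forall L, exists y, ~ (forall y, L y ->
    exists2 x, limit_body x & `|x - y| < e) -> L y /\ forall x, limit_body x -> e <= `|x - y|.
  move=> L; have [H|NL] := pselect (forall y, L y ->
    exists2 x, limit_body x & `|x - y| < e); first by exists 0.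
  apply: contrapT => N; apply: NL => y Ly; apply: contrapT => Nx; apply: N; exists y.
  move=> _; split => // x lx; rewrite leNgt; apply/negP => xy.
  by apply: Nx; exists x.
have [|z zl zlim] := @limit_point f; first by apply: filterS NU => L /fP[].
have [L [NL zf]] := filter_ex (filterI NU (zlim _ e0)).
by have := (fP _ NL).2 _ zl; rewrite leNgt => /negP; apply.
Qed.

End UltraLimit.

Section Compactness.
Context {R : realType} {d : nat}.
Local Notation E := 'rV[R]_d.+1.
Implicit Types (K L : set E).

                                                                                
                                                                                 
(** Without a finite cover, the sets [far s] generate a proper filter. The limit body K of an
    ultrafilter above it satisfies Sigma(K) >= a by continuity, while bodies arbitrarily close to K
    would belong to [far [:: K]]. *)
Lemma superlevel_compact (Sigma : set E -> R) (a : R) (rad : set E -> R) :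
  hausdorff_continuous_on (convex_body R d) Sigma ->
  (forall K, superlevel Sigma a K -> 0 < rad K) ->
  exists2 s : seq (set E), (forall K, K \in s -> superlevel Sigma a K) &
    forall L, superlevel Sigma a L -> exists2 K, K \in s & hausdorff_dist K L < rad K.
Proof.
move=> cSigma rad0; apply: contrapT => /forall2NP nocover.
pose far (s : seq (set E)) : set (set E) := [set L | superlevel Sigma a L /\
  forall K, K \in s -> superlevel Sigma a K -> rad K <= hausdorff_dist K L].
have farP : ProperFilter (filter_from [set: seq (set E)] far).
  apply: filter_from_proper.
    apply: filter_fromT_filter; first by exists [::].
    move=> s t; exists (s ++ t) => L [bL Lst]; split; split => // K Ks; apply: Lst;
      by rewrite mem_cat Ks ?orbT.
  move=> s _; have [|/existsNP[L /not_implyP[bL NL]]] :=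
    nocover [seq K <- s | `[< superlevel Sigma a K >]].
    by move=> []K; rewrite mem_filter => /andP[/asboolP].
  exists L; split => // K Ks bK; rewrite leNgt; apply/negP => KL; apply: NL.
  by exists K => //; rewrite mem_filter Ks andbT; apply/asboolP.
have [U [UU farU]] := ultraFilterLemma farP.
have Ufar s : U (far s) by apply: farU; exists s.
have Ubody : U (convex_body R d) by apply: filterS (Ufar [::]) => L [[]].
pose K := limit_body U.
have bK : convex_body R d K by exact: limit_body_convex.
have Uhd r : 0 < r -> U [set L | convex_body R d L /\ hausdorff_dist K L < r].
  move=> r0; have [e e0 er] := @close_hausdorff R d r r0.
  apply: filterS2 Ubody (limit_body_close Ubody e0) => L bL KL; split => //.
  by apply: er KL => //; [exact: convex_body_sub|exact: convex_body_sub|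
    exact: convex_body_nonempty|exact: convex_body_nonempty].
have SK : superlevel Sigma a K.
  split => //; rewrite leNgt; apply/negP => SKa.
  have [r r0 rP] := cSigma K bK _ (etrans (subr_gt0 _ _) SKa).
  have [L [[bL KL] [[_ aL] _]]] := filter_ex (filterI (Uhd r r0) (Ufar [::])).
  by have := rP L bL KL; rewrite ltr_norml => /andP[+ _]; lra.
have [L [[bL KL] [_ /(_ K)]]] := filter_ex (filterI (Uhd _ (rad0 K SK)) (Ufar [:: K])).
by rewrite mem_head leNgt KL => /(_ isT SK).
Qed.

End Compactness.

                                           

(** * Hitting sets of bodies and their finite inner approximation *)

Lemma compact_finite_cover (T : topologicalType) (K : set T) (V : T -> set T) :
  compact K -> (forall x, K x -> nbhs x (V x)) ->
  exists2 s : seq T, (forall x, x \in s -> K x) &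
    forall y, K y -> exists2 x, x \in s & V x y.
Proof.
move=> cK VK; apply: contrapT => /forall2NP nocover.
pose far (s : seq T) : set T :=
  [set y | K y /\ forall x, x \in s -> K x -> ~ V x y].
have FF : Filter (filter_from [set: seq T] far).
  apply: filter_fromT_filter; first by exists [::].
  move=> s t; exists (s ++ t) => y [Ky yst]; split; split => // x xs; apply: yst;
    by rewrite mem_cat xs ?orbT.
have farP : ProperFilter (filter_from [set: seq T] far).
  apply: filter_from_proper => s _.
  have [|/existsNP[y /not_implyP[Ky Ny]]] := nocover [seq x <- s | `[< K x >]].
    by move=> []x; rewrite mem_filter => /andP[/asboolP].
  exists y; split => // x xs Kx Vxy; apply: Ny; exists x => //.
  by rewrite mem_filter xs andbT; apply/asboolP.
have [|x [Kx xcl]] := cK _ farP; first by exists [::] => // y [].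
have [|y [[_ /(_ x)]]] := xcl (far [:: x]) (V x) _ (VK _ Kx); first by exists [:: x].
by rewrite mem_head => /(_ isT Kx).
Qed.

Section HittingSets.
Context {R : realType} {d : nat}.
Local Notation E := 'rV[R]_d.+1.
Implicit Types (K L : set E) (x y z u v w : E).

Definition hits K : set E := [set x | sphere R d x /\ exists2 y, K y & dotp x y = 0].

(** The hyperplane of x meets the convex hull of [J]; the set is empty when [J] is. *)
Definition hits_seq (J : seq E) : set E :=
  [set x | [/\ sphere R d x, ~ (forall y, y \in J -> 0 < dotp x y) &
             ~ (forall y, y \in J -> dotp x y < 0)]].

                                                                                  
                                                                                
                                                                              
(** For a convex body, the interior of the cone over it, written through the dual cone. In this form
    membership survives small perturbations of the body. *)
Definition deep K : set E :=
  [set y | forall u, sphere R d u -> (forall z, K z -> 0 <= dotp u z) -> 0 < dotp u y].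

(** Outer approximation, decreasing to [hits K]; it contains [hits L] for L close enough to K. *)
Definition near_hits K (n : nat) : set E :=
  sphere R d `&` [set x | exists2 y, K y & `|dotp x y| < n.+1%:R^-1].

(** Inner approximation: hyperplanes with points of K on both sides at a margin. It increases to
    [hits K] up to tangent hyperplanes. *)
Definition split_hits K (n : nat) : set E :=
  hits K `&` ([set x | exists2 y, K y & dotp x y < - n.+1%:R^-1] `&`
              [set x | exists2 y, K y & n.+1%:R^-1 < dotp x y]).

Lemma two_U1 K : 2 * U1 K = mu (hits K).
Proof. by rewrite /U1 mulrA divff ?mul1r// pnatr_eq0. Qed.

Lemma dotpl_continuous y : continuous (dotp^~ y : E -> R).
Proof.
rewrite (_ : dotp^~ y = dotp y); first exact: dotp_continuous.
by apply/funext => x; rewrite dotpC.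
Qed.

Lemma open_exists_dotp K (D : set R) : open D ->
  open [set x : E | exists2 y, K y & D (dotp x y)].
Proof.
move=> oD; rewrite (_ : mkset _ = \bigcup_(y in K) (dotp^~ y @^-1` D)).
  by apply: bigcup_open => y _; apply: open_comp => // x _; exact: dotpl_continuous.
by apply/seteqP; split => x [y]; exists y.
Qed.

Lemma open_borel (A : set E) : open A -> borel_set A.
Proof. exact: sub_sigma_algebra. Qed.

Lemma closed_borel (A : set E) : closed A -> borel_set A.
Proof.
by move=> /closed_openC/open_borel oA; rewrite -[A]setCK; exact: (@measurableC _ (borel E)).
Qed.

Lemma borel_sphere : borel_set (sphere R d).
Proof. exact: closed_borel sphere_closed. Qed.

Lemma borel_near_hits K n : borel_set (near_hits K n).
Proof.
apply: (@measurableI _ (borel E)); first exact: borel_sphere.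
apply: open_borel.
apply: (open_exists_dotp (D := @Num.Def.normr R R @^-1` [set t | t < n.+1%:R^-1])).
by apply: open_comp; [move=> t _; exact: norm_continuous|exact: open_lt].
Qed.

Lemma near_hits_bigcap K : compact K -> K !=set0 -> \bigcap_n near_hits K n = hits K.
Proof.
move=> cK K0; apply/seteqP; split => [x xK|x [Sx [y Ky xy]] n _]; last first.
  by split => //; exists y => //; rewrite xy normr0 invr_gt0.
split; first by have [] := xK 0%N I.
have cnorm : continuous (fun y => `|dotp x y|).
  by move=> y; apply: continuous_comp; [exact: dotp_continuous|exact: norm_continuous].
have [y] := compact_EVT_min K0 cK (continuous_subspaceT cnorm).
rewrite inE => Ky ymin; exists y => //; apply/eqP; rewrite -normr_le0 leNgt.
apply/negP => xy0.
have [n] : exists n, n.+1%:R^-1 < `|dotp x y|.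
  exists (Num.truncn (`|dotp x y|^-1)).
  by rewrite invf_plt ?posrE ?ltr0n// truncnS_gt.
have [_ [z Kz xz]] := xK n I; move=> /(lt_trans xz); rewrite ltNge ymin//.
by rewrite inE.
Qed.

Lemma borel_hits K : compact K -> K !=set0 -> borel_set (hits K).
Proof.
move=> cK K0; rewrite -near_hits_bigcap//.
apply: (@bigcapT_measurable _ (borel E)) => n; exact: borel_near_hits.
Qed.

Lemma borel_split_hits K n : compact K -> K !=set0 -> borel_set (split_hits K n).
Proof.
move=> cK K0; apply: (@measurableI _ (borel E)); first exact: borel_hits.
apply: open_borel; apply: openI.
  by apply: (open_exists_dotp (D := [set t | t < - n.+1%:R^-1])); exact: open_lt.
by apply: (open_exists_dotp (D := [set t | n.+1%:R^-1 < t])); exact: open_gt.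
Qed.

Lemma borel_hits_seq (J : seq E) : borel_set (hits_seq J).
Proof.
have allB (D : set R) : open D -> borel_set [set x | forall y, y \in J -> D (dotp x y)].
  move=> oD; apply: open_borel; elim: J => [|y J IHJ].
    by rewrite (_ : mkset _ = setT); [exact: openT|apply/seteqP; split].
  rewrite (_ : mkset _ = dotp^~ y @^-1` D `&` [set x | forall y, y \in J -> D (dotp x y)]).
    by apply: openI => //; apply: open_comp => // x _; exact: dotpl_continuous.
  apply/seteqP; split => [x xJ|x [xy xJ] z].
    by split => [|z zJ]; apply: xJ; rewrite inE ?eqxx ?zJ ?orbT.
  by rewrite inE => /orP[/eqP->//|]; exact: xJ.
rewrite (_ : hits_seq J = sphere R d `&` (~` [set x | forall y, y \in J -> 0 < dotp x y]
    `&` ~` [set x | forall y, y \in J -> dotp x y < 0])).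
  apply: (@measurableI _ (borel E)); first exact: borel_sphere.
  apply: (@measurableI _ (borel E)); apply: (@measurableC _ (borel E)).
    by apply: (allB [set t | 0 < t]); exact: open_gt.
  by apply: (allB [set t | t < 0]); exact: open_lt.
by apply/seteqP; split => x; [case|case=> ? []].
Qed.

                                                                        
                           
Definition tangent K : set E :=
  hits K `\` [set x | exists2 y, K y & dotp x y < 0].

Lemma borel_tangent K : compact K -> K !=set0 -> borel_set (tangent K).
Proof.
move=> cK K0; apply: (@measurableD _ (borel E)); first exact: borel_hits.
apply: open_borel.
by apply: (open_exists_dotp (D := [set t | t < 0])); exact: open_lt.
Qed.

(** The cone over [tangent K] lies in the convex set of vectors nonnegative on K, and no point of it
    is inner there: a small step in the direction -y, where y in K is orthogonal to it, leaves the
    set. So it is thin. *)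
Lemma mu_tangent K : K `<=` sphere R d -> mu (tangent K) = 0.
Proof.
move=> KS; rewrite /mu /sigma.
rewrite (@lebesgue_rV_thin _ _ [set x : E | forall z, K z -> 0 <= dotp x z]) ?mul0e//.
  move=> v w t /andP[t0 t1] /= vK wK z Kz; rewrite dotpDl !dotpZl.
  by rewrite addr_ge0// mulr_ge0 ?vK ?wK ?subr_ge0.
move=> _ [t /andP[t0 _] [x [[[Sx [y Ky xy]] xK] _] <-]]; split => [z Kz|].
  rewrite dotpZl mulr_ge0// leNgt; apply/negP => xz.
  by apply: xK; exists z.
move=> [e e0 /(_ (t *: x - (e / 2) *: y)) inC].
have /inC/(_ y Ky) : forall i, `|(t *: x - (e / 2) *: y) 0 i - (t *: x) 0 i| < e.
  move=> i; rewrite !mxE [X in `|X|](_ : _ = - (e / 2 * y 0 i)); last by ring.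
  rewrite normrN normrM ger0_norm ?divr_ge0 ?(ltW e0)//.
  have := coord_le_norm y i; have := sphere_norm_le1 (KS _ Ky).
  set b := `|y|; set c := `|_|; nra.
rewrite dotpDl dotpNl !dotpZl xy mulr0 add0r (KS _ Ky : dotp y y = 1) mulr1 oppr_ge0.
by rewrite leNgt divr_gt0.
Qed.

(** A hyperplane that meets K either has points of K strictly on both sides, hence with some margin
    1/(n+1), or is tangent to K or to -K. *)
Lemma hits_split K : hits K `<=`
  \bigcup_n split_hits K n `|` (tangent K `|` tangent (-%R @` K)).
Proof.
move=> x /[dup] xK [Sx [y Ky xy]].
have [[v Kv xv]|Nv] := pselect (exists2 v, K v & dotp x v < 0); last first.
  by right; left; split.
have [[w Kw xw]|Nw] := pselect (exists2 w, K w & 0 < dotp x w); last first.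
  right; right; split.
    by split => //; exists (- y); [exists y|rewrite dotpNr xy oppr0].
  move=> [_ [z Kz <-]]; rewrite dotpNr oppr_lt0 => xz; apply: Nw.
  by exists z.
left; pose c := Num.min (- dotp x v) (dotp x w).
have c0 : 0 < c by rewrite lt_min oppr_gt0 xv xw.
have [n nc] : exists n, n.+1%:R^-1 < c.
  by exists (Num.truncn c^-1); rewrite invf_plt ?posrE ?ltr0n// truncnS_gt.
move: nc; rewrite lt_min => /andP[nv nw].
exists n => //; split => //; split; [exists v|exists w] => //.
by rewrite ltrNr.
Qed.

End HittingSets.

(** * Finite point sets that approximate full-dimensional bodies *)

Section LocalApproximation.
Context {R : realType} {d : nat}.
Local Notation E := 'rV[R]_d.+1.
Implicit Types (K L : set E) (x y z u v w : E).

Lemma full_dim_not_orthogonal K u : has_sphere_dim K d -> sphere R d u ->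
  exists2 y, K y & dotp u y != 0.
Proof.
move=> [U [_ Umin dU]] Su; apply: contrapT => /forall2NP Ky.
pose V := lker (linfun (mulmxr (u^T : 'cV[R]_d.+1) : E -> 'rV[R]_1)).
have VP x : (x \in V) = (dotp u x == 0).
  rewrite memv_ker lfunE /= dotpC; apply/eqP/eqP => [/matrixP/(_ 0 0)|xu].
    by rewrite !mxE => xu; rewrite -[RHS]xu; apply: eq_bigr => i _; rewrite mxE.
  apply/matrixP => i j; rewrite !ord1 !mxE -[RHS]xu.
  by apply: eq_bigr => k _; rewrite mxE.
have /(Umin V)/subvP UV : forall x, K x -> x \in V.
  by move=> x Kx; rewrite VP; have [//|/negP/negPn] := Ky x.
have UE : U = fullv.
  by apply/eqP; rewrite eqEdim subvf dU dimvf /dim/= mul1n.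
have := UV u; rewrite UE memvf VP => /(_ isT).
by rewrite dotpp_eq0 (negPf (sphere_neq0 Su)).
Qed.

(** Each unit u has a y in K not orthogonal to it, and the same y serves near u. Finitely many y
    serve the whole sphere, and the continuous positive sum attains its minimum m. *)
Lemma spanning_sublist K : compact K -> has_sphere_dim K d ->
  exists2 Y : seq E, (forall y, y \in Y -> K y) &
  exists2 m : R, 0 < m & forall u, sphere R d u -> m <= \sum_(y <- Y) `|dotp u y|.
Proof.
move=> cK Kdim.
have /choice[h hP] : forall u, exists y, sphere R d u -> K y /\ dotp u y != 0.
  move=> u; have [Su|] := pselect (sphere R d u); last by exists 0.
  by have [y Ky uy] := full_dim_not_orthogonal Kdim Su; exists y.
have [|s sS scov] := compact_finite_cover (V := fun u => [set w | dotp w (h u) != 0])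
    (@sphere_compact R d).
  move=> u Su; apply: open_nbhs_nbhs; split; last exact: (hP u Su).2.
  rewrite (_ : mkset _ = dotp^~ (h u) @^-1` [set t | t != 0]) //.
  by apply: open_comp => [x _|]; [exact: dotpl_continuous|exact: open_neq].
exists [seq h u | u <- s] => [_ /mapP[u us ->]|]; first exact: (hP u (sS u us)).1.
pose g u := \sum_(y <- [seq h u | u <- s]) `|dotp u y|.
have cg : continuous g.
  apply: (continuous_big (@add_continuous R)) => y _ u.
  apply: (@continuous_comp _ _ _ (dotp^~ y) (@Num.Def.normr R R)).
    exact: dotpl_continuous.
  exact: norm_continuous.
have [S0|/set0P[u0 Su0]] := eqVneq (sphere R d) set0; first by exists 1 => // u; rewrite S0.
have [|c] := compact_EVT_min _ (@sphere_compact R d) (continuous_subspaceT cg).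
  by exists u0.
rewrite inE => Sc cmin; exists (g c) => [|u Su]; last by apply: cmin; rewrite inE.
have [u us cu] := scov c Sc.
rewrite /g big_map (big_rem u us)/= ltr_pwDl ?normr_gt0// sumr_ge0// => *.
Qed.

(** A number s >= -e satisfies |s| <= s + 2e. Hence the sum of a spanning list lies well inside any
    half-space that almost contains the list. *)
Lemma sum_dotp_ge (Y : seq E) (u : E) (m e : R) : 0 <= e ->
  m <= \sum_(y <- Y) `|dotp u y| -> (forall y, y \in Y -> - e <= dotp u y) ->
  m - 2 * (size Y)%:R * e <= dotp u (\sum_(y <- Y) y).
Proof.
move=> e0 mY uY; rewrite dotp_sumr lerBlDr; apply: le_trans mY _.
have -> : 2 * (size Y)%:R * e = \sum_(y <- Y) (2 * e).
  by rewrite big_const_seq count_predT iter_addr_0 -mulr_natr; ring.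
rewrite -big_split big_seq [leRHS]big_seq; apply: ler_sum => y /uY uy /=.
by rewrite ler_norml; apply/andP; split; lra.
Qed.

Context {dO : measure_display} {Omega : measurableType dO}.
Context {P : probability Omega R} {g : R} {X : Omega -> seq E}.
Hypothesis g_gt0 : 0 < g.
Hypothesis ppX : poisson_process P g X.

                                                                              
                                                                           
                                                   
(** [J] is a fine net of K shifted slightly by t b, where b is the sum of a spanning list. The shift
    puts the net in the interior of the cones over all nearby L, yet is too small to spoil the
    two-sided margin of the hyperplanes in [split_hits K n2]. Bodies L near K satisfy that [hits L]
    lies in [near_hits K n1]. Each of these two approximations of [hits K] costs eta/2. *)
Lemma local_approximation K (eta : R) : convex_body R d K -> has_sphere_dim K d ->
  0 < eta -> exists2 J : seq E, J != [::] &
  exists2 r, 0 < r & forall L, convex_body R d L -> hausdorff_dist K L < r ->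
    (forall y, y \in J -> deep L y) /\ mu (hits L) <= mu (hits_seq J) + eta.
Proof.
move=> bK Kdim eta0.
have cK := convex_body_compact bK; have K0 := convex_body_nonempty bK.
have KS := convex_body_sub bK.
have eta20 : 0 < eta / 2 by rewrite divr_gt0.
pose D : R := d.+1%:R; have D0 : 0 < D by rewrite ltr0n.
have [n1 n1P] : exists n, mu (near_hits K n) < mu (hits K) + eta / 2.
  rewrite -near_hits_bigcap//; apply: (mu_bigcap g_gt0 ppX) => //.
    by move=> n; exact: borel_near_hits.
  move=> n m nm x [Sx [y Ky xy]]; split => //; exists y => //.
  by apply: lt_le_trans xy _; rewrite lef_pV2 ?posrE// ler_nat.
have [n2 n2P] : exists n, mu (hits K) < mu (split_hits K n) + eta / 2.
  have [|n m nm|//|n nP] := mu_bigcup (F := split_hits K) (e := eta / 2) g_gt0 ppX.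
  - by move=> n; exact: borel_split_hits.
  - have nmV : m.+1%:R^-1 <= n.+1%:R^-1 :> R by rewrite lef_pV2 ?posrE// ler_nat.
    move=> x [xK [[y Ky xy] [z Kz xz]]]; split => //; split.
      by exists y => //; apply: lt_le_trans xy _; rewrite lerN2.
    by exists z => //; apply: le_lt_trans xz.
  exists n; apply: le_lt_trans nP.
  have KN : compact (-%R @` K).
    by apply: continuous_compact cK; apply: continuous_subspaceT; exact: oppr_continuous.
  have bT : borel_set (tangent K) by exact: borel_tangent.
  have bTN : borel_set (tangent (-%R @` K)).
    by apply: borel_tangent => //; exact: image_nonempty.
  have bU : borel_set (\bigcup_n split_hits K n).
    by apply: (@bigcupT_measurable _ (borel E)) => k; exact: borel_split_hits.
  have bUT : borel_set (\bigcup_n split_hits K n `|` tangent K).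
    exact: (@measurableU _ (borel E)).
  apply: (@le_trans _ _ (mu (\bigcup_n split_hits K n `|` tangent K))).
    apply: (mu_le_null g_gt0 ppX _ bUT bTN); first exact: borel_hits.
      by rewrite -setUA; exact: hits_split.
    by apply: mu_tangent => _ [y Ky <-]; exact/sphereN/KS.
  by apply: (mu_le_null g_gt0 ppX bUT bU bT) => //; exact: mu_tangent.
have [Y YK [m m0 mY]] := spanning_sublist cK Kdim.
pose b := \sum_(y <- Y) y.
pose dl : R := n2.+1%:R^-1; have dl0 : 0 < dl by rewrite invr_gt0.
have e10 : 0 < dl / (2 * D) by rewrite divr_gt0// mulr_gt0.
have [|s sK scov] := compact_finite_cover (V := fun y => ball y (dl / (2 * D))) cK.
  by move=> x _; exact: nbhsx_ballx.
(* The net and the shift each change the product with a unit vector by less than dl/2, which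
   together stay within the margin dl. The factor D = d+1 bounds that product by the sup norm. *)
pose t := dl / (4 * D * (1 + `|b|)).
have b1 : 0 < 1 + `|b| by rewrite ltr_pwDl.
have t0 : 0 < t by rewrite divr_gt0// !mulr_gt0.
have tb u : sphere R d u -> `|t * dotp u b| < dl / 2.
  move=> Su; rewrite normrM gtr0_norm//; have := sphere_dotp_le b Su; rewrite -/D.
  have b0 : 0 <= `|b| by []. move=> ub.
  have : t * (4 * D * (1 + `|b|)) = dl by rewrite /t divfK// gt_eqF// !mulr_gt0.
  move: ub; set c := `|dotp _ _|; set bb := `|b| in b0 b1 t t0 * => ub tdl.
  have : t * c <= t * (D * bb) by rewrite ler_pM2l.
  have : 0 <= t * D by rewrite mulr_ge0// ltW.
  nra.
exists [seq z + t *: b | z <- s].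
  have [y Ky] := K0; have [z zs _] := scov y Ky.
  by apply/eqP => J0; have := map_f (fun z => z + t *: b) zs; rewrite J0.
have split_sub : split_hits K n2 `<=` hits_seq [seq z + t *: b | z <- s].
  move=> x [[Sx _] [[y Ky xy] [y' Ky' xy']]].
  have near z y1 : ball z (dl / (2 * D)) y1 -> `|dotp x z - dotp x y1| < dl / 2.
    rewrite -ball_normE/= -dotpNr -dotpDr ltr_pdivlMr ?mulr_gt0// => zy1.
    by have := sphere_dotp_le (z - y1) Sx; rewrite -/D; lra.
  split => // [xJ|xJ].
    have [z zs zy] := scov y Ky; have := xJ _ (map_f _ zs).
    rewrite dotpDr dotpZr; have := near _ _ zy; have := tb _ Sx.
    rewrite !ltr_norml => /andP[_ tx] /andP[_ zx]; move: xy; rewrite -/dl; lra.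
  have [z zs zy] := scov y' Ky'; have := xJ _ (map_f _ zs).
  rewrite dotpDr dotpZr; have := near _ _ zy; have := tb _ Sx.
  rewrite !ltr_norml => /andP[tx _] /andP[zx _]; move: xy'; rewrite -/dl; lra.
(* If u is nonnegative on L, it is at least -De on K, so on z + t b it is at least t m - D e q. The
   first bound on e makes this positive; the second, De <= 1/(n1+1), puts [hits L] into
   [near_hits K n1]. *)
pose q := 1 + 2 * t * (size Y)%:R.
have q0 : 0 < q.
  by rewrite /q -mulrA ltr_pwDl// mulr_ge0// mulr_ge0 ?ler0n// ltW.
pose e := Num.min (t * m / (2 * (D * q))) (n1.+1%:R^-1 / D).
have e0 : 0 < e.
  rewrite lt_min; apply/andP; split; last by rewrite divr_gt0 ?invr_gt0.
  by apply: divr_gt0; rewrite mulr_gt0// mulr_gt0.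
have [r r0 rP] := @hausdorff_close R d e e0.
exists r => // L bL /rP[] //; [exact: convex_body_sub|exact: convex_body_nonempty|].
move=> KL LK.
have De1 : D * e * q < t * m.
  have : e <= t * m / (2 * (D * q)) by rewrite /e ge_min lexx.
  have Dq : 0 < D * q by rewrite mulr_gt0.
  have tm : 0 < t * m by rewrite mulr_gt0.
  rewrite ler_pdivlMr ?mulr_gt0//.
  have -> : e * (2 * (D * q)) = 2 * (D * e * q) by ring.
  by move: tm; set u := t * m; set w := D * e * q; lra.
have De2 : D * e <= n1.+1%:R^-1.
  by rewrite mulrC -ler_pdivlMr// /e ge_min lexx orbT.
split.
  move=> _ /mapP[z zs ->] u Su uL.
  have uK y : K y -> - (D * e) <= dotp u y.
    move=> Ky; have [w Lw yw] := KL _ Ky.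
    have := sphere_dotp_le (y - w) Su; rewrite dotpDr dotpNr ler_norml => /andP[].
    have : D * `|y - w| <= D * e by rewrite ler_pM2l// ltW.
    by have := uL w Lw; rewrite -/D; lra.
  rewrite dotpDr dotpZr.
  have De0 : 0 <= D * e by rewrite mulr_ge0// ltW.
  have := sum_dotp_ge De0 (mY u Su) (fun y yY => uK y (YK y yY)); rewrite -/b.
  rewrite -(ler_pM2l t0) mulrBr => tbY.
  have qE : D * e * q = D * e + t * (2 * (size Y)%:R * (D * e)) by rewrite /q; ring.
  have := uK z (sK z zs); move: tbY De1; rewrite qE.
  by set x1 := t * (_ * _); set x2 := t * m; set x3 := D * e; set x4 := t * dotp _ _; lra.
have Lnear : hits L `<=` near_hits K n1.
  move=> x [Sx [y Ly xy]]; split => //; have [z Kz zy] := LK _ Ly.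
  exists z => //; have := sphere_dotp_le (z - y) Sx; rewrite dotpDr dotpNr xy subr0.
  move=> /le_lt_trans; apply; apply: lt_le_trans De2; by rewrite ltr_pM2l.
have : mu (hits L) <= mu (near_hits K n1).
  apply: (le_mu g_gt0 ppX) Lnear; last exact: borel_near_hits.
  by apply: borel_hits; [exact: convex_body_compact|exact: convex_body_nonempty].
have : mu (split_hits K n2) <= mu (hits_seq [seq z + t *: b | z <- s]).
  by apply: (le_mu g_gt0 ppX) split_sub; [exact: borel_split_hits|exact: borel_hits_seq].
lra.
Qed.

End LocalApproximation.

                                  

(** * Cells of the tessellation as intersections of hemispheres *)

Section Cells.
Context {R : realType} {d : nat}.
Local Notation E := 'rV[R]_d.+1.
Implicit Types (K L : set E) (x y z u v w : E) (s : seq E).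

Definition cellset s y : set E :=
  [set z | sphere R d z /\ forall x, x \in s -> 0 <= dotp x z * dotp x y].

Lemma comb_neq0 y z (a b : R) : sphere R d y -> sphere R d z -> z != - y ->
  0 <= a -> 0 <= b -> 0 < a + b -> a *: y + b *: z != 0.
Proof.
move=> Sy Sz zy a0 b0 ab; rewrite -dotpp_gt0 dotp_sqrD !(dotpZl, dotpZr).
rewrite (Sy : dotp y y = 1) (Sz : dotp z z = 1).
have : -1 < dotp y z.
  have /andP[+ _] := sphere_dotp_le1 Sy Sz; rewrite le_eqVlt => /orP[/eqP yz|//].
  by move: zy; rewrite (sphere_dotp_eqN1 Sz Sy) ?eqxx// dotpC.
have [a_0|a_neq0] := eqVneq a 0.
  by rewrite a_0 add0r in ab *; rewrite !mul0r mulr0 !add0r mulr1 !mulr_gt0.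
have [b_0|b_neq0] := eqVneq b 0.
  by rewrite b_0 addr0 in ab *; rewrite !mul0r !mulr0 !addr0 mulr1 !mulr_gt0.
have a1 : 0 < a by rewrite lt_def a_neq0.
have b1 : 0 < b by rewrite lt_def b_neq0.
move=> yz; have : 0 < a * b * (dotp y z + 1) by rewrite !mulr_gt0//; lra.
move=> p0; rewrite [ltRHS](_ : _ = (a - b) ^+ 2 + 2 * (a * b * (dotp y z + 1))); last by ring.
by rewrite ltr_wpDl ?sqr_ge0// mulr_gt0.
Qed.

Lemma component_path (B : set E) v w : (forall t : R, 0 <= t <= 1 ->
    (1 - t) *: v + t *: w != 0 /\ B (normalize ((1 - t) *: v + t *: w))) ->
  connected_component B (normalize v) (normalize w).
Proof.
move=> pathB; pose f (t : R) : E := (1 - t) *: v + t *: w.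
have cf t : f @ t --> f t.
  apply: (@cvgD R E _ (nbhs t) _ (fun t => (1 - t) *: v) (fun t => t *: w)).
    apply: (@cvgZr_tmp _ _ _ (nbhs t) _ (fun t : R => 1 - t)).
    by apply: (@cvgB R R _ (nbhs t) _ (fun=> 1) id); [exact: cvg_cst|exact: cvg_id].
  by apply: (@cvgZr_tmp _ _ _ (nbhs t) _ id); exact: cvg_id.
exists ((normalize \o f) @` `[0, 1]); last first.
  exists 1; first by rewrite /= in_itv/= ler01 lexx.
  by rewrite /f/= subrr scale0r add0r scale1r.
split.
- exists 0; first by rewrite /= in_itv/= ler01 lexx.
  by rewrite /f/= subr0 scale0r addr0 scale1r.
- by move=> _ [t /= + <-]; rewrite in_itv/= => /pathB[].
- apply: connected_continuous_connected; first exact: segment_connected.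
  apply: continuous_in_subspaceT => t; rewrite inE/= in_itv/= => /pathB[f0 _].
  by apply: continuous_comp; [exact: cf|exact: normalize_cvg].
Qed.

(** The image of a connected set under the product with x is an interval that avoids 0. *)
Lemma component_sign s y z : connected_component (off_hyperspheres s) y z ->
  forall x, x \in s -> 0 < dotp x z * dotp x y.
Proof.
move=> [B [By Boff cB] Bz] x xs.
have : connected (dotp x @` B).
  by apply: connected_continuous_connected => //; apply/continuous_subspaceT/dotp_continuous.
move/connected_intervalP => itvB.
have B0 w : B w -> dotp x w != 0 by move=> /Boff[_]; exact.
have Nx0 : ~ (dotp x @` B) 0 by move=> [w /B0/eqP].
have im w : B w -> (dotp x @` B) (dotp x w) by move=> Bw; exists w.
rewrite lt_def mulf_neq0 ?B0//= leNgt; apply/negP => neg; apply: Nx0.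
have [xz|xz] := leP 0 (dotp x z); last first.
  by apply: (itvB _ _ (im _ Bz) (im _ By)); rewrite ltW//=; nra.
by apply: (itvB _ _ (im _ By) (im _ Bz)); rewrite xz andbT; nra.
Qed.

Lemma dotp_mul_continuous x (c : R) : continuous (fun z => dotp x z * c).
Proof.
move=> z; apply: (@cvgM R E (nbhs z) _ (dotp x) (fun=> c)); last exact: cvg_cst.
exact: dotp_continuous.
Qed.

Lemma cellset_closed s y : closed (cellset s y).
Proof.
rewrite (_ : cellset s y = sphere R d `&`
    \bigcap_(x in [set x | x \in s]) ((fun z => dotp x z * dotp x y) @^-1` [set t | 0 <= t])).
  apply: closedI; first exact: sphere_closed.
  apply: closed_bigI => x _; apply: closed_comp => [z _|]; last exact: closed_ge.
  exact: dotp_mul_continuous.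
by apply/seteqP; split => z [Sz zs]; split => // x; exact: zs.
Qed.

Lemma off_normalize s v : v != 0 -> (forall x, x \in s -> dotp x v != 0) ->
  off_hyperspheres s (normalize v).
Proof.
move=> v0 sv; split; first exact: normalize_sphere.
by move=> x xs; rewrite dotpZr mulf_neq0 ?sv// invr_eq0 gt_eqF// sqrt_dotpp_gt0.
Qed.

Lemma sphere_third_point y : (0 < d)%N -> exists w, [/\ sphere R d w, w != y & w != - y].
Proof.
case: d y => // n y _; pose e (i : 'I_n.+2) : 'rV[R]_n.+2 := delta_mx 0 i.
have Se i : sphere R n.+1 (e i).
  rewrite /sphere/= /dotp (bigD1 i)//= big1 ?addr0 ?mxE ?eqxx ?mulr1// => j ji.
  by rewrite !mxE (negPf ji) mulr0.
have [e0|e0] := boolP ((e 0 != y) && (e 0 != - y)).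
  by exists (e 0); case/andP: e0.
exists (e 1); have e01 : (e 0 = e 1 -> False) /\ (e 0 = - e 1 -> False).
  by split => /rowP/(_ 0); rewrite !mxE /= ?mulr0n ?oppr0 => /eqP; rewrite oner_eq0.
have e10 : e 0 = y \/ e 0 = - y.
  by move: e0; rewrite negb_and !negbK => /orP[]/eqP; [left|right].
split; first exact: Se.
  by apply/eqP => e1; case: e01; case: e10 => ->; rewrite e1.
apply/eqP => e1; case: e01; case: e10 => ->; rewrite e1 ?opprK//.
Qed.

(** A point z with the same weak signs as y is a limit of normalized points z + t y, t > 0. These
    have strict signs and are joined to y by a normalized segment. *)
Lemma closure_component s y : (0 < d)%N -> off_hyperspheres s y ->
  closure (connected_component (off_hyperspheres s) y) = cellset s y.
Proof.
move=> d0 offy; have [Sy sy] := offy.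
apply/seteqP; split.
  rewrite [X in _ `<=` X]((closure_id _).1 (@cellset_closed s y)).
  apply: closure_subset => z yz; split.
    by have [] := connected_component_sub yz.
  by move=> x xs; exact/ltW/(component_sign yz).
have main z : cellset s y z -> z != - y ->
    closure (connected_component (off_hyperspheres s) y) z.
  move=> [Sz sz] zy V; have cz : (fun t : R => normalize (z + t *: y)) @ (0 : R) --> z.
    have c0 : (fun t : R => z + t *: y) @ (0 : R) --> z + 0 *: y.
      apply: (@cvgD R E _ (nbhs (0 : R)) _ (fun=> z) (fun t => t *: y)).
        exact: cvg_cst.
      by apply: (@cvgZr_tmp _ _ _ (nbhs (0 : R)) _ id); exact: cvg_id.
    rewrite -{2}(normalize_id Sz) -[in X in _ --> X](addr0 z) -(scale0r y).
    by apply: (cvg_comp _ normalize c0); apply: normalize_cvg;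
      rewrite scale0r addr0 sphere_neq0.
  move=> /cz/nbhs_ballP[r r0 rV]; exists (normalize (z + (r / 2) *: y)); split.
    rewrite -{1}(normalize_id Sy); apply: component_path => t /andP[t0 t1].
    have -> : (1 - t) *: y + t *: (z + (r / 2) *: y) = (1 - t + t * (r / 2)) *: y + t *: z.
      by rewrite scalerDr scalerA [in RHS]scalerDl -addrA (addrC (t *: z)).
    have c0 : 0 <= 1 - t + t * (r / 2).
      by rewrite addr_ge0 ?subr_ge0// mulr_ge0// divr_ge0// ltW.
    have w0 : (1 - t + t * (r / 2)) *: y + t *: z != 0.
      apply: comb_neq0 => //; have : 0 < r / 2 by rewrite divr_gt0.
      by move: (r / 2) => c; nra.
    split => //; apply: off_normalize => // x xs.
    rewrite dotpDr !dotpZr; have := sz x xs; have := sy x xs.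
    have [->|tn0] := eqVneq t 0; first by rewrite !mul0r subr0 !addr0 mul1r.
    have tp : 0 < t by rewrite lt_def tn0.
    have c1 : 0 < 1 - t + t * (r / 2) by rewrite ltr_wpDl ?subr_ge0// mulr_gt0// divr_gt0.
    move: (1 - t + _) c1 => c c1 xy xz; apply/eqP => H.
    have : c * (dotp x y * dotp x y) + t * (dotp x z * dotp x y) = 0.
      by rewrite -[RHS](mul0r (dotp x y)) -H; ring.
    have : 0 < dotp x y * dotp x y by rewrite -expr2 exprn_even_gt0.
    move=> yy; have : 0 < c * (dotp x y * dotp x y) by rewrite mulr_gt0.
    have : 0 <= t * (dotp x z * dotp x y) by rewrite mulr_ge0.
    lra.
  have r20 : 0 < r / 2 by rewrite divr_gt0.
  by apply: rV; rewrite /ball/= sub0r normrN gtr0_norm//; lra.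
(* The antipode of y breaks the segment argument. It satisfies the sign conditions only if the list
   is empty, and then it is reached through a third point of the sphere. *)
move=> z yz; have [zy|] := eqVneq z (- y); last exact: main.
case: s offy sy yz main => [|x s] offy sy [Sz yz] main; last first.
  have xs : x \in x :: s by rewrite mem_head.
  have := yz x xs; rewrite zy dotpNr mulNr oppr_ge0 leNgt lt_def mulf_neq0 ?sy//=.
  by rewrite -expr2 sqr_ge0.
apply: subset_closure; have [w [Sw wy wNy]] := sphere_third_point y d0.
have path a b : sphere R d a -> sphere R d b -> b != - a ->
    connected_component (off_hyperspheres [::]) a b.
  move=> Sa Sb ab; rewrite -(normalize_id Sa) -(normalize_id Sb).
  apply: component_path => t /andP[t0 t1].
  have ab0 : (1 - t) *: a + t *: b != 0 by apply: comb_neq0 => //; lra.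
  by split => //; exact: off_normalize.
apply: (@connected_component_trans _ _ w); first exact: path.
apply: path => //; rewrite zy; apply: contra wy => /eqP/oppr_inj ->//.
Qed.

Lemma cellsP s K : (0 < d)%N ->
  cells s K <-> exists2 y, off_hyperspheres s y & K = cellset s y.
Proof.
move=> d0; split=> [[y sy <-]|[y sy ->]]; exists y => //; rewrite closure_component//.
Qed.

Lemma cellset_nil y : cellset [::] y = sphere R d.
Proof. by apply/seteqP; split => z; [case|split]. Qed.

Lemma cellset_convex_body s y : s != [::] -> off_hyperspheres s y ->
  convex_body R d (cellset s y).
Proof.
move=> s0 [Sy sy]; exists [set z | forall x, x \in s -> 0 <= dotp x z * dotp x y]; split.
- split.
  + rewrite (_ : mkset _ =
      \bigcap_(x in [set x | x \in s]) ((fun z => dotp x z * dotp x y) @^-1` [set t | 0 <= t])).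
      apply: closed_bigI => x _; apply: closed_comp => [z _|]; last exact: closed_ge.
      exact: dotp_mul_continuous.
    by apply/seteqP; split.
  + by move=> x xs /=; rewrite dotp0 mul0r.
  + move=> a b v w a0 b0 sv sw x xs /=.
    rewrite dotpDr !dotpZr mulrDl -!mulrA addr_ge0// mulr_ge0//; [exact: sv|exact: sw].
- move=> [U UE]; case: s s0 sy UE => // x s _ sy UE.
  have xs : x \in x :: s by rewrite mem_head.
  have /(_ x xs) : [set z | forall u, u \in x :: s -> 0 <= dotp u z * dotp u y] (- y).
    rewrite UE /= memvN.
    have : [set z | forall u, u \in x :: s -> 0 <= dotp u z * dotp u y] y.
      by move=> u us; rewrite -expr2 sqr_ge0.
    by rewrite UE.
  rewrite dotpNr mulNr oppr_ge0 leNgt lt_def mulf_neq0 ?sy//=.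
  by rewrite -expr2 sqr_ge0.
- by apply/seteqP; split => z [].
Qed.

Lemma sphere_not_convex_body : ~ convex_body R d (sphere R d).
Proof.
move=> /convex_bodyP[cC nC SE]; have [v Cv NCv] := cone_no_opposite cC nC.
have v0 : - v != 0.
  by rewrite oppr_eq0; apply: contra_not_neq NCv => ->; rewrite oppr0; case: cC.
have [_ Cn] : (sphere R d `&` cone (sphere R d)) (normalize (- v)).
  by rewrite -SE; exact: normalize_sphere.
apply: NCv; have := cone_scale cC (sqrtr_ge0 (dotp (- v) (- v))) Cn.
by rewrite scalerA mulfV ?scale1r// gt_eqF// sqrt_dotpp_gt0.
Qed.

Lemma cellset_compact s y : off_hyperspheres s y -> sphere_compacts (cellset s y).
Proof.
move=> [Sy sy]; split; last by move=> z [].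
  by apply: subclosed_compact (@sphere_compact R d) _; [exact: cellset_closed|move=> z []].
by exists y; split => // x xs; rewrite -expr2 sqr_ge0.
Qed.

Lemma convex_body_third_point K y : (0 < d)%N -> has_sphere_dim K d ->
  exists w, [/\ K w, w != y & w != - y].
Proof.
move=> d0 [U [_ Umin dU]]; apply: contrapT => N.
have : (U <= <[y]>)%VS.
  apply: Umin => x Kx; have [->|xy] := eqVneq x y; first exact: memv_line.
  have [->|xNy] := eqVneq x (- y); first by rewrite memvN memv_line.
  by exfalso; apply: N; exists x.
move/dimvS; rewrite dU dim_vline; case: (y != 0) => /=; lia.
Qed.

(** Two points of K on opposite sides of the hyperplane span an arc in K that crosses it. If they
    are antipodal, a third point of K replaces one of them. *)
Lemma convex_body_sign K x y z : (0 < d)%N -> convex_body R d K -> has_sphere_dim K d ->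
  (forall w, K w -> dotp x w != 0) -> K y -> K z -> 0 < dotp x z * dotp x y.
Proof.
move=> d0 bK Kd xK Ky Kz; have KS := convex_body_sub bK.
have [cC _ KE] := convex_bodyP bK.
have sign v w : K v -> K w -> w != - v -> 0 < dotp x v -> dotp x w < 0 -> False.
  move=> Kv Kw wv xv xw; have w0 : 0 < - dotp x w by rewrite oppr_gt0.
  have n0 : - dotp x w *: v + dotp x v *: w != 0.
    by apply: comb_neq0; rewrite ?addr_gt0 ?(ltW w0) ?(ltW xv)//; exact: KS.
  have : K (normalize (- dotp x w *: v + dotp x v *: w)).
    rewrite KE; split; first exact: normalize_sphere.
    apply: (cone_scale cC); first by rewrite invr_ge0 sqrtr_ge0.
    by case: cC => _ _; apply; rewrite ?(ltW w0) ?(ltW xv)//;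
      [move: Kv|move: Kw]; rewrite {1}KE => -[].
  by move/xK/eqP; apply; rewrite /normalize !(dotpZr, dotpDr); ring.
have key v w : K v -> K w -> 0 < dotp x v -> dotp x w < 0 -> False.
  move=> Kv Kw xv xw; have [wv|wv] := eqVneq w (- v); last exact: (sign v w).
  have [u [Ku uv uNv]] := convex_body_third_point v d0 Kd.
  have [xu|xu|xu] := ltgtP (dotp x u) 0; last by move: (xK u Ku); rewrite xu eqxx.
    exact: (sign v u).
  apply: (sign u w) => //; rewrite wv; apply: contra uv => /eqP/oppr_inj ->//.
rewrite lt_def mulf_neq0 ?xK//= leNgt; apply/negP => neg.
have [xz|xz|xz] := ltgtP (dotp x z) 0; last by move: (xK z Kz); rewrite xz eqxx.
  by apply: (key y z) => //; nra.
by apply: (key z y) => //; nra.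
Qed.

(** Up to sign, x is nonnegative on the cell, so it is strictly positive at its deep points. *)
Lemma deep_cellset_sign s y x w : (forall x, x \in s -> sphere R d x) -> x \in s ->
  off_hyperspheres s y -> deep (cellset s y) w -> 0 < dotp x w * dotp x y.
Proof.
move=> sS xs [_ sy] wdeep; have [xy|xy|xy] := ltgtP (dotp x y) 0.
- rewrite -mulrNN -dotpNl mulr_gt0 ?oppr_gt0//; apply: wdeep.
    by apply: sphereN; exact: sS.
  by move=> z [_ /(_ x xs)]; rewrite dotpNl; nra.
- rewrite mulr_gt0//; apply: wdeep; first exact: sS.
  by move=> z [_ /(_ x xs)]; nra.
- by move: (sy x xs); rewrite xy eqxx.
Qed.

(** All of [J] lies strictly on the cell's side of each hyperplane of the tessellation, so none of
    these hyperplanes separates [J]. *)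
Lemma deep_cellset_void s y (J : seq E) : (forall x, x \in s -> sphere R d x) ->
  off_hyperspheres s y -> (forall w, w \in J -> deep (cellset s y) w) ->
  counts s (hits_seq J) = 0%N.
Proof.
move=> sS offy Jdeep; apply/counts_eq0 => x xs [_ NJ JN].
have [xy|xy|xy] := ltgtP (dotp x y) 0; last by move: (offy.2 x xs); rewrite xy eqxx.
  apply: JN => w wJ; have := deep_cellset_sign sS xs offy (Jdeep w wJ); nra.
by apply: NJ => w wJ; have := deep_cellset_sign sS xs offy (Jdeep w wJ); nra.
Qed.

(** A deep point fixes the sign of every hyperplane, and these signs determine the cell. *)
Lemma deep_cellset_inj s y y' w : (forall x, x \in s -> sphere R d x) ->
  off_hyperspheres s y -> off_hyperspheres s y' ->
  deep (cellset s y) w -> deep (cellset s y') w -> cellset s y = cellset s y'.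
Proof.
have aux v v' : (forall x, x \in s -> sphere R d x) ->
    off_hyperspheres s v -> off_hyperspheres s v' ->
    deep (cellset s v) w -> deep (cellset s v') w -> cellset s v `<=` cellset s v'.
  move=> sS sv sv' wv wv' z [Sz sz]; split => // x xs.
  have := deep_cellset_sign sS xs sv wv; have := deep_cellset_sign sS xs sv' wv'.
  have := sz x xs; move: (dotp x z) (dotp x v) (dotp x v') (dotp x w) => a b c e ab ec eb.
  have sq_gt0 (t : R) : t != 0 -> 0 < t * t by rewrite -expr2 exprn_even_gt0.
  have e0 : 0 < e * e by apply: sq_gt0; apply: contraTneq eb => ->; rewrite mul0r ltxx.
  have b0 : 0 < b * b by apply: sq_gt0; apply: contraTneq eb => ->; rewrite mulr0 ltxx.
  have : 0 < (e * e) * (b * c) by rewrite mulrACA mulr_gt0.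
  rewrite pmulr_rgt0// => bc.
  have : 0 <= (b * b) * (a * c) by rewrite mulrACA (mulrC b a) mulr_ge0// ltW.
  by rewrite pmulr_rge0.
by move=> sS sy sy' wy wy'; apply/seteqP; split; exact: aux.
Qed.

End Cells.

                                                  

(** * Rotations and the law of the typical cell *)

Section Rotations.
Context {R : realType} {d : nat}.
Local Notation E := 'rV[R]_d.+1.
Local Notation M := 'M[R]_d.+1.
Implicit Types (x y p u : E) (Q S : M).

Lemma rotvM Q S x : rotv (Q *m S) x = rotv Q (rotv S x).
Proof. by rewrite /rotv trmx_mul mulmxA. Qed.

Lemma SO_tr Q : SO R d Q -> SO R d Q^T.
Proof. by move=> [QQ dQ]; split; rewrite ?det_tr// trmxK; exact: mulmx1C. Qed.

Lemma rotv_preimage Q (K : set E) : SO R d Q -> rotv Q @^-1` K = rotv Q^T @` K.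
Proof.
move=> [QQ _]; have QQ' := mulmx1C QQ; apply/seteqP; split => [x Kx|_ [y Ky <-]] /=.
  by exists (rotv Q x) => //; rewrite -rotvM QQ' /rotv trmx1 mulmx1.
by rewrite -rotvM QQ /rotv trmx1 mulmx1.
Qed.

Lemma dotp_mulmx x y : x *m y^T = (dotp x y)%:M.
Proof.
apply/matrixP => i j; rewrite !ord1 mxE mxE eqxx mulr1n.
by apply: eq_bigr => k _; rewrite mxE.
Qed.

(** The reflection in the hyperplane orthogonal to p - x. *)
Lemma householder p x : sphere R d p -> sphere R d x ->
  exists2 H : M, H *m H^T = 1%:M & rotv H p = x.
Proof.
move=> Sp Sx; have [<-|px] := eqVneq p x.
  by exists 1%:M; rewrite ?trmx1 ?mulmx1// /rotv trmx1 mulmx1.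
have [u uE] : exists u, u = p - x by exists (p - x).
have u0 : dotp u u != 0 by rewrite dotpp_eq0 uE subr_eq0.
pose H : M := 1%:M - (2 / dotp u u) *: (u^T *m u).
have uu := dotp_mulmx u u; have pu := dotp_mulmx p u.
have HT : H^T = H by rewrite /H linearB linearZ/= trmx1 trmx_mul trmxK.
exists H.
  have PP : (u^T *m u) *m (u^T *m u) = dotp u u *: (u^T *m u).
    by rewrite mulmxA -(mulmxA u^T) uu mul_mx_scalar scalemxAl.
  rewrite HT /H; move: (u^T *m u) PP => P0 PP.
  rewrite mulmxBl mul1mx mulmxBr mulmx1 -scalemxAl -scalemxAr PP.
  by apply/matrixP => i j; rewrite !mxE; field.
rewrite /rotv HT /H mulmxBr mulmx1 -scalemxAr mulmxA pu mul_scalar_mx scalerA.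
have -> : 2 / dotp u u * dotp p u = 1.
  have puE : 2 * dotp p u = dotp u u.
    rewrite uE sphere_dist2// dotpDr dotpNr (Sp : dotp p p = 1); ring.
  by rewrite mulrAC puE divff.
by rewrite scale1r uE subKr.
Qed.

(** If the reflection has determinant -1, precede it by a reflection that fixes p: diag(-1,1,...,1),
    which fixes the last basis vector, conjugated by an orthogonal map taking that vector to p. *)
Lemma rotation_transitive p x : (0 < d)%N -> sphere R d p -> sphere R d x ->
  exists2 Q, SO R d Q & rotv Q p = x.
Proof.
move=> d0 Sp Sx; have [H HH Hp] := householder Sp Sx.
have detsq (A : M) : A *m A^T = 1%:M -> \det A * \det A = 1.
  by move=> AA; rewrite -{2}[A]trmxK det_tr -det_mulmx AA det1.
have /eqP := detsq _ HH; rewrite -expr2 sqrf_eq1 => /orP[/eqP dH|/eqP dH].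
  by exists H.
pose e : E := delta_mx 0 ord_max.
have Se : sphere R d e.
  rewrite /sphere/= /dotp (bigD1 ord_max)//= big1 ?addr0 ?mxE ?eqxx ?mulr1// => j ji.
  by rewrite !mxE (negPf ji) mulr0.
pose v : E := \row_j (if j == ord0 then -1 else 1).
pose D : M := diag_mx v.
have DT : D^T = D by exact: tr_diag_mx.
have DD : D *m D^T = 1%:M.
  rewrite DT mulmx_diag -diag_const_mx; congr diag_mx; apply/rowP => j; rewrite !mxE.
  by case: ifP; rewrite ?mulrNN ?mulr1.
have De : rotv D e = e.
  rewrite /rotv DT; apply/rowP => j; rewrite mul_mx_diag !mxE eqxx /=.
  have [->|] := eqVneq j ord_max; last by rewrite mul0r.
  by rewrite ifF ?mulr1//; apply/negbTE; rewrite -val_eqE/= -lt0n.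
have dD : \det D = -1.
  rewrite det_diag (bigD1 ord0)//= big1 ?mulr1 ?mxE ?eqxx// => j j0.
  by rewrite mxE (negPf j0).
have [H1 HH1 H1e] := householder Se Sp.
have H1p : rotv H1^T p = e.
  by rewrite -H1e -rotvM (mulmx1C HH1) /rotv trmx1 mulmx1.
exists (H *m (H1 *m D *m H1^T)); last by rewrite !rotvM H1p De H1e.
split.
  have orthM (A B : M) : A *m A^T = 1%:M -> B *m B^T = 1%:M ->
      (A *m B) *m (A *m B)^T = 1%:M.
    by move=> AA BB; rewrite trmx_mul -mulmxA (mulmxA B) BB mul1mx.
  have HT1 : H1^T *m H1^T^T = 1%:M by rewrite trmxK; exact: mulmx1C.
  exact: orthM HH (orthM _ _ (orthM _ _ HH1 DD) HT1).
rewrite !det_mulmx det_tr dH dD -[RHS](detsq _ HH1); ring.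
Qed.

Lemma entry_continuous (i j : 'I_d.+1) : continuous (fun Q : M => Q i j).
Proof. exact: coord_continuous. Qed.

Lemma closed_SO : closed (SO R d : set M).
Proof.
rewrite (_ : SO R d = \bigcap_(ij in [set: 'I_d.+1 * 'I_d.+1])
    ((fun Q : M => \sum_k Q ij.1 k * Q ij.2 k) @^-1` [set ((1%:M : M) ij.1 ij.2)]) `&`
    (fun Q : M => \det Q) @^-1` [set 1]).
  apply: closedI.
    apply: closed_bigI => -[i j] _; apply: closed_comp => [Q _|]; last exact: closed_eq.
    apply: (continuous_big (@add_continuous R)) => k _ {}Q.
    apply: (@cvgM R M (nbhs Q) _ (fun Q : M => Q i k) (fun Q : M => Q j k));
      exact: entry_continuous.
  apply: closed_comp => [Q _|]; last exact: closed_eq.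
  apply: (continuous_big (@add_continuous R)) => s _ {}Q.
  apply: (@cvgM R M (nbhs Q) _ (fun=> (-1) ^+ perm.odd_perm s)
    (fun Q : M => \prod_i Q i (perm.fun_of_perm s i))); first exact: cvg_cst.
  by apply: (continuous_big (@mul_continuous R)) => i _ {}Q; exact: entry_continuous.
apply/seteqP; split => [Q [QQ dQ]|Q [QQ dQ]]; split => //.
  by move=> [i j] _ /=; rewrite -QQ mxE; apply: eq_bigr => k _; rewrite mxE.
apply/matrixP => i j; have /= <- := QQ (i, j) I.
by rewrite mxE; apply: eq_bigr => k _; rewrite mxE.
Qed.

Lemma closed_borel_mx (A : set M) : closed A -> borel_set A.
Proof.
move=> /closed_openC oA; rewrite -[A]setCK; apply: (@measurableC _ (borel M)).
exact: sub_sigma_algebra.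
Qed.

Lemma borel_SO : borel_set (SO R d : set M).
Proof. exact: closed_borel_mx closed_SO. Qed.

Lemma borel_stabilizer p : borel_set (stabilizer p : set M).
Proof.
apply: closed_borel_mx; rewrite (_ : stabilizer p = SO R d `&` \bigcap_(i in [set: 'I_d.+1])
    ((fun Q : M => \sum_k p 0 k * Q i k) @^-1` [set p 0 i])).
  apply: closedI; first exact: closed_SO.
  apply: closed_bigI => i _; apply: closed_comp => [Q _|]; last exact: closed_eq.
  apply: (continuous_big (@add_continuous R)) => k _ {}Q.
  by apply: (@cvgM R M (nbhs Q) _ (fun=> p 0 k) (fun Q : M => Q i k));
    [exact: cvg_cst|exact: entry_continuous].
apply/seteqP; split => Q [SQ Qp]; split => //.
  move=> i _ /=; rewrite -[RHS](congr1 (fun v : E => v 0 i) Qp) mxE.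
  by apply: eq_bigr => k _; rewrite mxE.
apply/rowP => i; have /= <- := Qp i I; rewrite mxE.
by apply: eq_bigr => k _; rewrite mxE.
Qed.

Lemma kappa0_SO p (kappa0 : E -> probability (borel M) R) x : (0 < d)%N ->
  sphere R d p -> kappa0_kernel p kappa0 -> sphere R d x \/ x = 0 ->
  kappa0 x (SO R d) = 1%E.
Proof.
move=> d0 Sp [[k1 _] k2 [k3 _]] [Sx|->//].
have [Q SQ Qp] := rotation_transitive d0 Sp Sx.
rewrite (k2 x Q Sx SQ Qp _ borel_SO).
have -> : [set S | SO R d (Q *m S)] = SO R d.
  have SOM (A B : M) : SO R d A -> SO R d B -> SO R d (A *m B).
    move=> [AA dA] [BB dB]; split; last by rewrite det_mulmx dA dB mulr1.
    by rewrite trmx_mul -mulmxA (mulmxA B) BB mul1mx.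
  apply/seteqP; split => S SS; last exact: SOM.
  have := SOM _ _ (SO_tr SQ) SS; rewrite mulmxA.
  by case: SQ => /mulmx1C -> _; rewrite mul1mx.
apply/eqP; rewrite eq_le probability_le1//=; last exact: borel_SO.
rewrite -k1; apply: le_measure; rewrite ?inE; [exact: borel_stabilizer|exact: borel_SO|].
by move=> S [].
Qed.

Context {dO : measure_display} {Omega : measurableType dO}.

(** On each cell the indicator of A is constant along rotations, and every kernel [kappa0 (c K)]
    gives mass one to the rotation group. *)
Lemma typical_cell_law_invariant (P : probability Omega R) (X : Omega -> seq E)
    (p : E) (kappa0 : E -> probability (borel M) R) (c : set E -> E) (A : set (set E)) :
  (0 < d)%N -> sphere R d p -> kappa0_kernel p kappa0 -> centre_function c ->
  (forall w K S, cells (X w) K -> SO R d S -> A (rotv S @` K) <-> A K) ->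
  typical_cell_law P X c kappa0 A = ((cell_intensity P X)^-1 *
    \int[P]_w \esum_(K in cells (X w)) (\1_A K)%:E)%E.
Proof.
move=> d0 Sp kP cP Ainv; congr (_ * _)%E; apply: eq_integral => w _.
apply: eq_esum => K cK; have mSO : measurable (SO R d : set (borel M)) by exact: borel_SO.
rewrite (eq_integral (fun=> (\1_A K)%:E)) => [|S /set_mem SS]; last first.
  rewrite rotv_preimage// !indicE; congr ((nat_of_bool _)%:R%:E); apply/idP/idP; rewrite !inE.
    by move/(Ainv w K _ cK (SO_tr SS)).
  by move=> AK; apply/(Ainv w K _ cK (SO_tr SS)).
rewrite integral_cst//= (kappa0_SO d0 Sp kP) ?mule1//.
apply: (centre_range cP); move/(cellsP _ _ d0): cK => [y sy ->].
exact: cellset_compact.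
Qed.

End Rotations.

                                 

                                                                                   
                                                                            
(** * Expected numbers of cells *)

Lemma le_integral_ge0 d (T : measurableType d) (R : realType)
    (m : {measure set T -> \bar R}) (f g : T -> \bar R) :
  (forall x, (0 <= f x)%E) -> (forall x, (f x <= g x)%E) ->
  (\int[m]_x f x <= \int[m]_x g x)%E.
Proof.
move=> f0 fg; have g0 x : (0 <= g x)%E by exact: le_trans (fg x).
(* The integral of a nonnegative function is a supremum over simple functions below it. This gives
   monotonicity for cell counts without a proof that they are measurable. *)
rewrite !ge0_integralTE//; apply: ereal_sup_le => _ [h hf <-].
by exists h => // x; exact: le_trans (hf x) (fg x).
Qed.

Lemma esum_indic_le_sum (R : realType) (T T' : choiceType) (C G : set T) (r : seq T')
    (b : T' -> \bar R) (phi : T -> T') :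
  (forall J, (0 <= b J)%E) ->
  (forall K, C K -> G K -> phi K \in r /\ b (phi K) = 1%E) ->
  (forall K L, C K -> G K -> C L -> G L -> phi K = phi L -> K = L) ->
  (\esum_(K in C) (\1_G K)%:E <= \sum_(J <- undup r) b J)%E.
Proof.
move=> b0 phir phi_inj.
have -> : (\esum_(K in C) (\1_G K)%:E = \esum_(J in phi @` (C `&` G)) b J)%E.
  rewrite esum_image; last first.
    by move=> K L /[!inE] -[CK GK] [CL GL]; exact: phi_inj.
  rewrite esum_mkcondr; apply: eq_esum => K CK; rewrite indicE; case: ifPn => //.
  by rewrite inE => GK; rewrite (phir K CK GK).2.
rewrite fsbig_seq ?undup_uniq// -esum_fset; last by [].
  apply: ereal_sup_le => _ [F [finF FC] <-]; exists F => //; split => // J /FC[K [CK GK] <-].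
  by rewrite /= mem_undup; exact: (phir K CK GK).1.
exact: finite_seq.
Qed.

                                                                                
                                                                
(** The intensity r cancels. In the degenerate cases r = 0, r infinite or D infinite, the
    conventions for extended reals make the left side 0. *)
Lemma conditional_le (R : realType) (r N D : \bar R) (t : R) :
  (0 <= r)%E -> (0 <= N)%E -> (0 < D)%E -> 0 <= t -> (N <= t%:E * D)%E ->
  ((r^-1 * N) / (r^-1 * D) <= t%:E)%E.
Proof.
move=> r0 N0 D0 t0 ND.
have t0' : (0 <= t%:E)%E by rewrite lee_fin.
case: r r0 => [r| |] r0; [|by rewrite invey !mul0e|by rewrite leeNy_eq in r0].
have [->|r_neq0] := eqVneq r 0; first by rewrite inve0 (gt0_mulye D0) invey mule0.
have {}r0 : 0 < r by rewrite lt_def r_neq0.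
rewrite inver (negPf r_neq0).
case: D D0 ND => [q| |] D0 ND; [|by rewrite gt0_muley ?lte_fin ?invr_gt0// invey mule0|by []].
rewrite lte_fin in D0; case: N N0 ND => [n| |] N0 ND; last 2 first.
- by rewrite -EFinM leye_eq in ND.
- by rewrite leeNy_eq in N0.
rewrite -EFinM inver mulf_eq0 invr_eq0 (negPf r_neq0) gt_eqF//= -!EFinM lee_fin.
rewrite -EFinM lee_fin in ND.
by rewrite -mulf_div mulfV ?mul1r ?ler_pdivrMr// invr_eq0.
Qed.

Section CellCounts.
Context {R : realType} {d : nat}.
Local Notation E := 'rV[R]_d.+1.
Implicit Types (x y p u : E) (Q S : 'M[R]_d.+1).

Lemma rotv_dotp Q x y : SO R d Q -> dotp (rotv Q x) (rotv Q y) = dotp x y.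
Proof.
move=> [/mulmx1C QQ _]; suff : (dotp (rotv Q x) (rotv Q y))%:M = (dotp x y)%:M :> 'M[R]_1.
  by move/matrixP/(_ 0 0); rewrite !mxE.
by rewrite -!dotp_mulmx /rotv trmx_mul trmxK mulmxA -(mulmxA x) QQ mulmx1.
Qed.

Lemma rotv_cellset Q s y : SO R d Q ->
  rotv Q @` cellset s y = cellset (map (rotv Q) s) (rotv Q y).
Proof.
move=> SQ; apply/seteqP; split => [_ [z [Sz sz] <-]|z [Sz sz]].
  split; first by rewrite /sphere/= rotv_dotp.
  by move=> _ /mapP[x xs ->]; rewrite !rotv_dotp//; exact: sz.
have [u uz] : exists u, rotv Q u = z.
  by exists (rotv Q^T z); rewrite -rotvM; case: SQ => -> _; rewrite /rotv trmx1 mulmx1.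
rewrite -uz; exists u => //; split; first by move: Sz; rewrite -uz /sphere/= rotv_dotp.
move=> x xs; have := sz _ (map_f _ xs); rewrite -uz !rotv_dotp//.
Qed.

Lemma rotv_off Q s y : SO R d Q -> off_hyperspheres s y ->
  off_hyperspheres (map (rotv Q) s) (rotv Q y).
Proof.
move=> SQ [Sy sy]; split; first by rewrite /sphere/= rotv_dotp.
by move=> _ /mapP[x xs ->]; rewrite rotv_dotp//; exact: sy.
Qed.

Lemma cells_cases s (K : set E) : (0 < d)%N -> cells s K ->
  K = sphere R d \/ convex_body R d K.
Proof.
move=> d0 /(cellsP _ _ d0)[y sy ->]; have [->|s0] := eqVneq s [::].
  by left; rewrite cellset_nil.
by right; exact: cellset_convex_body.
Qed.

Lemma rotv_cells Q s (K : set E) : (0 < d)%N -> SO R d Q -> cells s K ->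
  cells (map (rotv Q) s) (rotv Q @` K).
Proof.
move=> d0 SQ /(cellsP _ _ d0)[y sy ->]; apply/(cellsP _ _ d0); exists (rotv Q y).
  exact: rotv_off.
exact: rotv_cellset.
Qed.

Lemma rotv_sphere Q : SO R d Q -> rotv Q @` sphere R d = sphere R d.
Proof. by move=> SQ; rewrite -(@cellset_nil R d 0) rotv_cellset//= !cellset_nil. Qed.

Lemma cells_convex s (K : set E) : (0 < d)%N -> cells s K ->
  (convex_body R d K <-> s != [::]).
Proof.
move=> d0 /(cellsP _ _ d0)[y sy ->]; split => [|s0]; last exact: cellset_convex_body.
by apply: contraPneq => ->; rewrite cellset_nil; exact: sphere_not_convex_body.
Qed.

Lemma rotv_cells_convex Q s (K : set E) : (0 < d)%N -> SO R d Q -> cells s K ->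
  convex_body R d (rotv Q @` K) <-> convex_body R d K.
Proof.
move=> d0 SQ sK; rewrite (cells_convex d0 sK) (cells_convex d0 (rotv_cells d0 SQ sK)).
by rewrite -!size_eq0 size_map.
Qed.

Context {dO : measure_display} {Omega : measurableType dO}.
Context {P : probability Omega R} {g : R} {X : Omega -> seq E}.
Hypothesis g_gt0 : 0 < g.
Hypothesis ppX : poisson_process P g X.
Hypothesis d_gt0 : (0 < d)%N.

(** Assign to each cell in A a list [J] of points deep in it. Distinct cells get distinct lists, and
    [hits_seq J] is then free of process points. So the number of cells is at most the number of
    lists with a void hitting set, each of probability at most exp(-g m). *)
Lemma esum_cells_le (A : set (set E)) (Js : seq (seq E)) (m : R) :
  (forall K, A K -> convex_body R d K /\
     exists2 J, J \in Js & J != [::] /\ forall y, y \in J -> deep K y) ->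
  (forall J, J \in Js -> m <= mu (hits_seq J)) ->
  ((\int[P]_w \esum_(K in cells (X w)) (\1_A K)%:E) <=
     ((size Js)%:R * expR (- (g * m)))%:E)%E.
Proof.
move=> AJ Jm.
have /choice[phi phiP] : forall K, exists J, A K ->
    [/\ J \in Js, J != [::] & forall y, y \in J -> deep K y].
  move=> K; have [/AJ[_ [J JJs [J0 Jd]]]|] := pselect (A K); last by exists [::].
  by exists J.
pose b J w : \bar R := (\1_(void (X := X) (hits_seq J)) w)%:E.
have mvoid J : measurable (void (X := X) (hits_seq J)).
  by apply: (measurable_void ppX); exact: borel_hits_seq.
have bound w : ((\esum_(K in cells (X w)) (\1_A K)%:E) <= \sum_(J <- undup Js) b J w)%E.
  have XS x : x \in X w -> sphere R d x by exact: (pp_sphere ppX).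
  apply: (esum_indic_le_sum (phi := phi)).
  - by move=> J; rewrite lee_fin.
  - move=> K /(cellsP _ _ d_gt0)[y sy ->] AK; have [JJs _ Jd] := phiP _ AK; split => //.
    by rewrite /b indicE mem_set//; exact: deep_cellset_void sy Jd.
  - move=> K L /(cellsP _ _ d_gt0)[y sy ->] AK /(cellsP _ _ d_gt0)[z sz ->] AL KL.
    have [_ J0 Kd] := phiP _ AK; have [_ _ Ld] := phiP _ AL.
    have [v vJ] : exists v, v \in phi (cellset (X w) y).
      by case: (phi _) J0 => [//|v J] _; exists v; rewrite mem_head.
    rewrite -KL in Ld; exact: deep_cellset_inj XS sy sz (Kd v vJ) (Ld v vJ).
apply: (@le_trans _ _ (\int[P]_w \sum_(J <- undup Js) b J w)%E).
  by apply: le_integral_ge0 => // w; apply: esum_ge0 => K _; rewrite lee_fin.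
rewrite ge0_integral_sum//; last 2 first.
  - by move=> J; apply/measurable_EFinP; exact: measurable_indic.
  - by move=> J w _; rewrite lee_fin.
apply: (@le_trans _ _ (\sum_(J <- undup Js) (expR (- (g * m)))%:E)%E).
  rewrite big_seq [leRHS]big_seq; apply: lee_sum => J; rewrite mem_undup => JJs.
  rewrite integral_indic// setIT [leLHS](void_prob ppX (borel_hits_seq J)).
  by rewrite lee_fin ler_expR lerN2 ler_pM2l// Jm.
rewrite sumEFin lee_fin big_const_seq count_predT iter_addr_0 -[leLHS]mulr_natl.
by rewrite ler_pM2r ?expR_gt0// ler_nat size_undup.
Qed.

(** When no hyperplane of the process meets [K0], the cell of any point of [K0] contains all of
    it. *)
Lemma esum_cells_ge (B : set (set E)) (K0 : set E) :
  convex_body R d K0 -> has_sphere_dim K0 d ->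
  (forall w K, cells (X w) K -> K0 `<=` K -> B K) ->
  ((expR (- (g * mu (hits K0))))%:E <= \int[P]_w \esum_(K in cells (X w)) (\1_B K)%:E)%E.
Proof.
move=> bK dK BK.
have bh : borel_set (hits K0).
  by apply: borel_hits; [exact: convex_body_compact|exact: convex_body_nonempty].
have mvoid : measurable (void (X := X) (hits K0)) by exact: (measurable_void ppX).
rewrite -(void_prob ppX bh) -[X in P X]setIT -integral_indic//.
apply: le_integral_ge0 => w; first by rewrite lee_fin.
have [wK0|Nw] := pselect (void (X := X) (hits K0) w); last first.
  by rewrite indicE memNset//=; apply: esum_ge0 => K _; rewrite lee_fin.
rewrite indicE mem_set//=; move/counts_eq0: wK0 => wK.
have [y Ky] := convex_body_nonempty bK.
have xK x : x \in X w -> forall z, K0 z -> dotp x z != 0.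
  move=> xX z Kz; apply/eqP => xz; apply: (wK x xX); split; last by exists z.
  exact: (pp_sphere ppX xX).
have sy : off_hyperspheres (X w) y.
  by split => [|x xX]; [exact: convex_body_sub Ky|exact: xK].
pose K := cellset (X w) y.
have cK : cells (X w) K by apply/(cellsP _ _ d_gt0); exists y.
have K0K : K0 `<=` K.
  move=> z Kz; split; first exact: convex_body_sub Kz.
  by move=> x xX; apply/ltW/(convex_body_sign d_gt0 bK dK) => //; exact: xK.
apply: esum_ge; exists [set K]; first by split; [exact: finite_set1|move=> _ ->].
by rewrite fsbig_set1 indicE mem_set//; exact: BK cK K0K.
Qed.

End CellCounts.

Theorem theorem9p6 (R : realType) (d : nat)
    (Sigma theta : set 'rV[R]_d.+1 -> R) (a eps kappa : R) :
  let Phi : set 'rV[R]_d.+1 -> R := fun K => 2 * U1 K in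
  (2 <= d)%N ->
  size_functional Sigma ->
  increasing_functional Sigma ->
  rotation_invariant_on (convex_body R d) Sigma ->
  simple_functional Sigma ->
  (forall K, convex_body R d K -> Sigma K <= Sigma (sphere R d)) ->
  0 < a ->
  superlevel Sigma a !=set0 ->
  rotation_invariant_on (superlevel Sigma a) theta ->
  deviation_functional Phi Sigma a theta ->
  0 < eps <= 1 ->
  0 < kappa < 1 ->
  exists2 c10 : R, 0 < c10 &
    forall f : R -> R, stability_function Phi Sigma a theta f ->
    forall p : 'rV[R]_d.+1, sphere R d p ->
    forall kappa0 : 'rV[R]_d.+1 -> probability (borel 'M[R]_d.+1) R,
      kappa0_kernel p kappa0 ->
    forall c : set 'rV[R]_d.+1 -> 'rV[R]_d.+1, centre_function c ->
    forall gamma : R, 0 < gamma ->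
    forall (dO : measure_display) (Omega : measurableType dO)
      (P : probability Omega R) (X : Omega -> seq 'rV[R]_d.+1),
      poisson_process P gamma X ->
    (cond_law (typical_cell_law P X c kappa0)
       [set K | convex_body R d K /\ (eps <= theta K)%R]
       [set K | (a <= Sigma K)%R]
     <= (c10 * expR (- (kappa * gamma * f eps * tau Phi Sigma a)))%:E)%E.
Proof.
move=> Phi d2 sizeS incS rotS simpS topS a0 S0 rotT devT eps01 /andP[kap0 kap1].
have d0 : (0 < d)%N by exact: ltnW.
have cS := size_continuous sizeS.
                                                                               
                                    
(* The properties of [mu] need some Poisson process, fixed before the constant is chosen. If there
   is none, at any intensity and on any space, the claim is vacuous. *)
have [[g0 [dO0 [Om0 [P0 [X0 [g0_gt0 pp0]]]]]]|Nex] := pselect (exists (g : R)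
    (dO : measure_display) (Omega : measurableType dO) (P : probability Omega R)
    (X : Omega -> seq 'rV[R]_d.+1), 0 < g /\ poisson_process P g X); last first.
  exists 1 => // f _ p _ kappa0 _ c _ g g_gt0 dO Omega P X ppX.
  by exfalso; apply: Nex; exists g, dO, Omega, P, X.
have PhiE K : Phi K = mu (hits K) by exact: two_U1.
set t0 := tau Phi Sigma a.
have dimS K : superlevel Sigma a K -> has_sphere_dim K d.
  by move=> [bK aK]; apply: contrapT => /(simpS K bK) SK; move: aK; rewrite SK leNgt a0.
have Phi_ge0 K : superlevel Sigma a K -> 0 <= Phi K.
  move=> [bK _]; rewrite PhiE; apply: (mu_ge0 g0_gt0 pp0).
  by apply: borel_hits; [exact: convex_body_compact|exact: convex_body_nonempty].
have lbPhi (D : set (set 'rV[R]_d.+1)) : D `<=` superlevel Sigma a ->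
    has_lbound [set Phi K | K in D].
  by move=> DS; exists 0 => _ [K DK <-]; apply: Phi_ge0; exact: DS.
have tau_le K : superlevel Sigma a K -> t0 <= Phi K.
  by move=> SK; apply: ge_inf; [exact: lbPhi|exists K].
have t0_ge0 : 0 <= t0.
  by apply: lb_le_inf; [exact: image_nonempty|move=> _ [K SK <-]; exact: Phi_ge0].
pose bad := [set K | superlevel Sigma a K /\ eps <= theta K].
(* [del] is the gap between tau and the infimum of Phi over bad bodies. It dominates f(eps) tau for
   every stability function f, which makes the constant uniform in f. If there are no bad bodies, 1
   + t0 will do because f <= 1. *)
have [del [del0 badP fP]] : exists del, [/\ 0 <= del,
    forall K, bad K -> t0 + del <= Phi K &
    forall f, stability_function Phi Sigma a theta f -> f eps * t0 <= del].
  have [bad0|/set0P bad_n0] := eqVneq bad set0.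
    exists (1 + t0); split => [|K|f sf]; first by rewrite addr_ge0.
      by rewrite bad0.
    have /andP[epos _] := eps01.
    have /andP[_ f1] := stab_range sf (ltW epos).
    by rewrite (@le_trans _ _ t0)// ?ler_piMl// lerDr.
  have bad_sub : bad `<=` superlevel Sigma a by move=> K [].
  exists (inf [set Phi K | K in bad] - t0); split.
  - rewrite subr_ge0; apply: lb_le_inf; first exact: image_nonempty.
    by move=> _ [K bK <-]; exact/tau_le/bad_sub.
  - move=> K bK; rewrite addrC subrK; apply: ge_inf; last by exists K.
    exact: lbPhi.
  - move=> f sf; rewrite lerBrDl; apply: lb_le_inf; first exact: image_nonempty.
    move=> _ [K [SK eK] <-]; have /andP[/ltW epos _] := eps01.
    by have := stab_lower sf epos SK eK; rewrite mulrDl mul1r.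
have invB s K S : cells s K -> SO R d S ->
    (a <= Sigma (rotv S @` K)) <-> (a <= Sigma K).
  move=> sK SS; have [->|bK] := cells_cases d0 sK; first by rewrite rotv_sphere.
  by rewrite rotS.
have invAB s K S : cells s K -> SO R d S ->
    ([set K | convex_body R d K /\ eps <= theta K] `&` [set K | a <= Sigma K])
      (rotv S @` K) <->
    ([set K | convex_body R d K /\ eps <= theta K] `&` [set K | a <= Sigma K]) K.
  move=> sK SS /=; rewrite (invB s)// (rotv_cells_convex d0 SS sK).
  by split=> -[[bK eT] aK]; split => //; split => //; move: eT; rewrite rotT.
have denominator g (g_gt0 : 0 < g) (dO : measure_display) (Omega : measurableType dO)
    (P : probability Omega R) X (ppX : poisson_process P g X) K0 :
    superlevel Sigma a K0 -> ((expR (- (g * Phi K0)))%:E <=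
      \int[P]_w \esum_(K in cells (X w)) (\1_[set K | a <= Sigma K] K)%:E)%E.
  move=> SK0; rewrite PhiE; apply: (esum_cells_ge ppX d0 SK0.1 (dimS _ SK0)) => w K cK K0K /=.
  (* A cell containing K0 is a convex body, where Sigma is increasing, or the whole sphere, where
     the convention on Sigma applies. *)
  apply: le_trans SK0.2 _; have [->|bK] := cells_cases d0 cK; first exact: topS SK0.1.
  exact: incS SK0.1 bK K0K.
have integrals_ge0 (A : set (set 'rV[R]_d.+1)) (dO : measure_display)
    (Omega : measurableType dO) (P : probability Omega R) (X : Omega -> seq 'rV[R]_d.+1) :
    (0 <= \int[P]_w \esum_(K in cells (X w)) (\1_A K)%:E)%E.
  by apply: integral_ge0 => w _; apply: esum_ge0 => K _; rewrite lee_fin.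
have intensity_ge0 (dO : measure_display) (Omega : measurableType dO)
    (P : probability Omega R) (X : Omega -> seq 'rV[R]_d.+1) : (0 <= cell_intensity P X)%E.
  by apply: integral_ge0 => w _; apply: esum_ge0 => K _; rewrite lee_fin.
                                                                              
                    
(* With no gap the exponent on the right is nonnegative, so the trivial bound 1 suffices. *)
have [del_eq0|del_neq0] := eqVneq del 0.
  exists 1 => // f /fP fdel p Sp kappa0 kP c cP g g_gt0 dO Omega P X ppX.
  rewrite /cond_law (typical_cell_law_invariant P d0 Sp kP cP (fun w => @invAB (X w))).
  rewrite (typical_cell_law_invariant P d0 Sp kP cP (fun w => @invB (X w))).
  apply: (@le_trans _ _ 1%E); last first.
    rewrite mul1r lee_fin -[leLHS]expR0 ler_expR oppr_ge0 -mulrA.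
    by apply: mulr_ge0_le0; [rewrite mulr_ge0 ?ltW|rewrite -del_eq0].
  have [K1 SK1] := S0.
  apply: conditional_le => //.
    by apply: lt_le_trans (denominator _ g_gt0 _ _ _ _ ppX K1 SK1); rewrite lte_fin expR_gt0.
  rewrite mul1e; apply: le_integral_ge0 => w.
    by apply: esum_ge0 => K _; rewrite lee_fin.
  apply: le_esum => K _; rewrite lee_fin !indicE.
  have [/set_mem[_ BK]|] := boolP (K \in _ `&` _); last by rewrite ler0n.
  by rewrite mem_set.
have del_gt0 : 0 < del by rewrite lt_def del_neq0.
(* One eta is lost in the numerator and one in the denominator, leaving del - 2 eta = kappa del. *)
pose eta := (1 - kappa) * del / 2.
have eta0 : 0 < eta by rewrite divr_gt0// mulr_gt0// subr_gt0.
have /choice[J JP] : forall K, exists Jr : seq 'rV[R]_d.+1 * R, superlevel Sigma a K ->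
    [/\ Jr.1 != [::], 0 < Jr.2 & forall L, convex_body R d L ->
      hausdorff_dist K L < Jr.2 ->
      (forall y, y \in Jr.1 -> deep L y) /\ mu (hits L) <= mu (hits_seq Jr.1) + eta].
  move=> K; have [SK|] := pselect (superlevel Sigma a K); last by exists ([::], 0).
  have [J0 J0n [r r0 rP]] := local_approximation g0_gt0 pp0 SK.1 (dimS _ SK) eta0.
  by exists (J0, r).
have [||s sS scov] := @superlevel_compact _ _ Sigma a (fun K => (J K).2) => //.
  by move=> K /JP[].
pose m := t0 + del - eta.
(* Lists belonging to bad bodies pass this filter: mu(hits K) >= t0 + del there, and the
   approximation loses at most eta. *)
pose Js := [seq Jl <- [seq (J K).1 | K <- s] | m <= mu (hits_seq Jl)].
have [K1 SK1 K1lt] : exists2 K1, superlevel Sigma a K1 & Phi K1 < t0 + eta.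
  have [|_ [K1 SK1 <-] K1lt] := @inf_adherent _ [set Phi K | K in superlevel Sigma a] _ eta0.
    by split; [exact: image_nonempty|exact: lbPhi].
  by exists K1.
(* The summand 1 keeps the constant positive when [Js] is empty. *)
exists ((size Js)%:R + 1); first by rewrite ltr_wpDl.
move=> f /fP fdel p Sp kappa0 kP c cP g g_gt0 dO Omega P X ppX.
rewrite /cond_law (typical_cell_law_invariant P d0 Sp kP cP (fun w => @invAB (X w))).
rewrite (typical_cell_law_invariant P d0 Sp kP cP (fun w => @invB (X w))).
have numerator : ((\int[P]_w \esum_(K in cells (X w))
    (\1_([set K | convex_body R d K /\ eps <= theta K] `&` [set K | a <= Sigma K]) K)%:E) <=
    ((size Js)%:R * expR (- (g * m)))%:E)%E.
  apply: (esum_cells_le g_gt0 ppX d0) => [K [[bK eK] aK]|Jl]; last by rewrite mem_filter => /andP[].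
  split => //; have SK : superlevel Sigma a K by [].
  have [K' K's KK'] := scov K SK; have [J0 _ /(_ K bK KK')[Jdeep Jmu]] := JP _ (sS _ K's).
  exists (J K').1; last by [].
  rewrite mem_filter (map_f (fun K => (J K).1) K's) andbT /m.
  have := badP K (conj SK eK); rewrite PhiE; lra.
pose q := ((size Js)%:R + 1) * expR (- (g * (kappa * del))).
have q0 : 0 <= q by rewrite mulr_ge0 ?expR_ge0// addr_ge0.
apply: (@le_trans _ _ q%:E); last first.
  rewrite lee_fin ler_pM2l ?ltr_wpDl// ler_expR lerN2.
  by rewrite (mulrC kappa) -!mulrA ler_pM2l// ler_pM2l.
have Dge := denominator _ g_gt0 _ _ _ _ ppX K1 SK1.
apply: conditional_le => //; first by apply: lt_le_trans Dge; rewrite lte_fin expR_gt0.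
(* Here kappa del + Phi(K1) < kappa del + t0 + eta = t0 + del - eta = m. *)
apply: le_trans numerator _; apply: (@le_trans _ _ (q%:E * (expR (- (g * Phi K1)))%:E)%E).
  rewrite -EFinM lee_fin /q -mulrA -expRD; apply: ler_pM => //.
  - by rewrite lerDl.
  - rewrite ler_expR -opprD -mulrDr lerN2 ler_pM2l//.
    by move: K1lt; rewrite /m /eta; lra.
by rewrite lee_wpmul2l// lee_fin.
Qed.
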